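(* Let $k$ be a perfect field of characteristic two and let $\mathcal{N}=k^*\times k\times k\times(k/\mathrm{AS}(k))$. For $(a,b,c,d)\in\mathcal{N}$ let $C_{abcd}$ be the smooth projective curve of genus two over $k$ with quasi-affine model $y^2+y=ax^5+bx^4+cx^3+d$. Let $\Gamma=\{\lambda x+\nu : (\lambda,\nu)\in k^*\times k\}\simeq k^*\rtimes k$ be the affine group, acting on $\mathcal{N}$ by $$(a,b,c,d)^{\lambda x+\nu}=\big(\lambda^5a,\ \lambda^4(b+E_{ac}(\nu)),\ \lambda^3c,\ a\nu^5+b\nu^4+c\nu^3+d\big).$$ 1. For any $(a,b,c,d),(a',b',c',d')\in\mathcal{N}$, the curves $C_{a'b'c'd'}$ and $C_{abcd}$ are $k$-isomorphic if and only if $(a',b',c',d')=(a,b,c,d)^{\gamma}$ for some $\gamma\in\Gamma$. 2. The isotropy group of any $(a,b,c,d)\in\mathcal{N}$ under the action of $\Gamma$ is $\mathrm{Ker}(\delta_{abc})$, and there is an exact sequence $$1\to\langle\iota\rangle\to\mathrm{Aut}_k(C_{abcd})\to\mathrm{Ker}(\delta_{abc})\to1.$$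
   Context: $\mathrm{AS}(k)=\{x+x^2 : x\in k\}$. The fourth coordinate $d$ of an element of $\mathcal{N}$ is a class in $k/\mathrm{AS}(k)$; in the equation of the curve one uses any representative in $k$, which does not change the $k$-isomorphism class, and comparisons of fourth coordinates are in $k/\mathrm{AS}(k)$. For $a,c\in k$, $a\neq0$, put $E_{ac}(x)=a^4x^{16}+c^4x^8+c^2x^2+ax\in k[x]$. The product in $k^*\rtimes k$ is $(\lambda,\nu)(\lambda',\nu')=(\lambda\lambda',\lambda\nu'+\nu)$, and $(\lambda,\nu)$ is identified with the affine map $\lambda x+\nu$. For $a,b,c\in k$, $a\ne0$, let $$\Gamma_{abc}=\begin{cases}\{(1,\nu)\in k^*\rtimes k : E_{ac}(\nu)=0\}&\text{if }c\ne0,\\ \{(\lambda,\nu)\in k^*\rtimes k : \lambda^5=1,\ E_{ac}(\nu)=b(1+\lambda)\}&\text{if }c=0,\end{cases}$$ which is a subgroup of $k^*\rtimes k$, and let $\delta_{abc}\colon\Gamma_{abc}\to k/\mathrm{AS}(k)$ be the group homomorphism $(\lambda,\nu)\mapsto a\nu^5+b\nu^4+c\nu^3$. The hyperelliptic involution is $\iota\colon(x,y)\mapsto(x,y+1)$. Every $k$-automorphism of such a curve has the form $(x,y)\mapsto(\gamma(x),y+v(x))$ with $\gamma\in\Gamma$, $v(x)\in k(x)$, and the right-hand map of the exact sequence sends it to $\gamma$. *)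

(* Defs.v *)
From HB Require Import structures.
From mathcomp Require Import all_boot all_order all_algebra all_field.
From mathcomp Require Import ring_quotient mpoly ring.
From mathcomp Require Import boolp.

Set Implicit Arguments.
Unset Strict Implicit.
Unset Printing Implicit Defensive.

Import GRing.Theory.
Local Open Scope ring_scope.
Local Open Scope quotient_scope.

Definition perfect_field (k : fieldType) : Prop :=
  forall p : {poly k}, irreducible_poly p -> separable_poly p.

Definition is_algebraic_closure (k : fieldType) (K : closedFieldType)
    (iota : {rmorphism k -> K}) : Prop :=
  forall z : K, algebraicOver iota z.

Definition nonzero (k : fieldType) := {a : k | a != 0}.
HB.instance Definition _ (k : fieldType) := SubType.on (nonzero k).
HB.instance Definition _ (k : fieldType) := Choice.on (nonzero k).

Definition nz_mul (k : fieldType) (u v : nonzero k) : nonzero k :=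
  Sub (val u * val v) (mulf_neq0 (valP u) (valP v)).

Definition nz_exp (k : fieldType) (u : nonzero k) (n : nat) : nonzero k :=
  Sub (val u ^+ n) (expf_neq0 n (valP u)).

Lemma nz_inv_subproof (k : fieldType) (u : nonzero k) : (val u)^-1 != 0.
Proof. by rewrite invr_eq0 (valP u). Qed.

Definition nz_inv (k : fieldType) (u : nonzero k) : nonzero k :=
  Sub (val u)^-1 (nz_inv_subproof u).

Definition nz_one (k : fieldType) : nonzero k := Sub 1 (oner_neq0 k).

(* The pair (l, n) stands for the affine map l x + n; the product is
   composition of affine maps. *)
Definition affine_group (k : fieldType) := (nonzero k * k)%type.
HB.instance Definition _ (k : fieldType) := Choice.on (affine_group k).

Section AffineGroup.
Variable k : fieldType.
Implicit Types g h : affine_group k.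

Definition lin g : k := val g.1.
Definition trans g : k := g.2.

Definition aff_mul g h : affine_group k :=
  (nz_mul g.1 h.1, lin g * trans h + trans g).
Definition aff_one : affine_group k := (nz_one k, 0).
Definition aff_inv g : affine_group k :=
  (nz_inv g.1, - ((lin g)^-1 * trans g)).

Lemma aff_eq g h : lin g = lin h -> trans g = trans h -> g = h.
Proof.
by case: g h => [u x] [v y]; rewrite /lin /trans /= => /val_inj -> ->.
Qed.

Lemma lin_neq0 g : lin g != 0. Proof. exact: (valP g.1). Qed.

Lemma aff_mulA : associative aff_mul.
Proof.
move=> g h l; apply: aff_eq; rewrite /lin /trans /=; first by rewrite mulrA.
by rewrite mulrDr mulrA addrA.
Qed.

Lemma aff_mul1g : left_id aff_one aff_mul.
Proof.
move=> g; apply: aff_eq; rewrite /lin /trans /=; first by rewrite mul1r.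
by rewrite mul1r addr0.
Qed.

Lemma aff_mulg1 : right_id aff_one aff_mul.
Proof.
move=> g; apply: aff_eq; rewrite /lin /trans /=; first by rewrite mulr1.
by rewrite mulr0 add0r.
Qed.

Lemma aff_mulVg : left_inverse aff_one aff_inv aff_mul.
Proof.
move=> g; apply: aff_eq; rewrite /lin /trans /=.
  by rewrite mulVf // lin_neq0.
by rewrite subrr.
Qed.

Lemma aff_mulgV : right_inverse aff_one aff_inv aff_mul.
Proof.
move=> g; apply: aff_eq; rewrite /lin /trans /=.
  by rewrite mulfV // lin_neq0.
by rewrite mulrN mulrA mulfV ?lin_neq0 // mul1r addNr.
Qed.

HB.instance Definition _ := isGroup.Build (affine_group k)
  aff_mulA aff_mul1g aff_mulg1 aff_mulVg aff_mulgV.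

Lemma linM g h : lin (g * h)%g = lin g * lin h. Proof. by []. Qed.
Lemma transM g h : trans (g * h)%g = lin g * trans h + trans g.
Proof. by []. Qed.
Lemma lin1 : lin 1%g = 1. Proof. by []. Qed.
Lemma trans1 : trans 1%g = 0. Proof. by []. Qed.

End AffineGroup.

Section ArtinSchreier.
Variables (k : fieldType) (ch2 : 2%N \in [pchar k]).

Definition AS of 2%N \in [pchar k] : {pred k} :=
  fun d => `[< exists x : k, d = x + x ^+ 2 >].

Lemma AS_closed : zmod_closed (AS ch2).
Proof.
split=> [|u v /asboolP[x ->] /asboolP[y ->]]; apply/asboolP.
  by exists 0; rewrite expr0n addr0.
exists (x - y); rewrite sqrrB mulr2n (addrr_pchar2 ch2) subr0 opprD.
by rewrite [- y ^+ 2](oppr_pchar2 ch2) addrACA.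
Qed.

HB.instance Definition _ := GRing.isZmodClosed.Build k (AS ch2) AS_closed.

Definition kAS := Quotient.quot (AS ch2).
HB.instance Definition _ := GRing.Zmodule.on kAS.
HB.instance Definition _ := EqQuotient.on kAS.

Definition AS_class (d : k) : kAS := \pi_kAS d.

Lemma two0 : 2%:R = 0 :> k. Proof. exact: pcharf0 ch2. Qed.

Lemma AS_class_eq0 (d : k) : AS_class d = 0 <-> exists x, d = x + x ^+ 2.
Proof.
rewrite /AS_class; have -> : (0 : kAS) = \pi_kAS 0 by rewrite piE.
rewrite (rwP eqP) -Quotient.idealrBE subr0; split; first by move/asboolP.
by move=> h; apply/asboolP.
Qed.

Lemma AS_classD u v : AS_class (u + v) = AS_class u + AS_class v.
Proof. by rewrite /AS_class !piE. Qed.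

Lemma AS_class0 : AS_class 0 = 0.
Proof. by rewrite /AS_class !piE. Qed.

Lemma AS_class_sq u : AS_class (u ^+ 2) = AS_class u.
Proof.
apply/eqP; rewrite /AS_class -Quotient.idealrBE.
by apply/asboolP; exists u; rewrite (oppr_pchar2 ch2) addrC.
Qed.

Lemma AS_classN u : - AS_class u = AS_class u.
Proof.
by apply/eqP; rewrite eq_sym -addr_eq0 -AS_classD (addrr_pchar2 ch2) AS_class0.
Qed.

Lemma AS_classK (d : kAS) : AS_class (repr d) = d. Proof. exact: reprK. Qed.

End ArtinSchreier.

Definition E_poly (k : fieldType) (a c x : k) : k :=
  a ^+ 4 * x ^+ 16 + c ^+ 4 * x ^+ 8 + c ^+ 2 * x ^+ 2 + a * x.

Definition NN (k : fieldType) (ch2 : 2%N \in [pchar k]) :=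
  (nonzero k * k * k * kAS ch2)%type.

Section Action.
Variables (k : fieldType) (ch2 : 2%N \in [pchar k]).
Implicit Types (n : NN ch2) (g h : affine_group k).

Definition coef_a n : k := val n.1.1.1.
Definition coef_b n : k := n.1.1.2.
Definition coef_c n : k := n.1.2.
Definition coef_d n : kAS ch2 := n.2.

Definition act n g : NN ch2 :=
  (nz_mul (nz_exp g.1 5) n.1.1.1,
   lin g ^+ 4 * (coef_b n + E_poly (coef_a n) (coef_c n) (trans g)),
   lin g ^+ 3 * coef_c n,
   AS_class ch2 (coef_a n * trans g ^+ 5 + coef_b n * trans g ^+ 4
                 + coef_c n * trans g ^+ 3) + coef_d n).

Definition Gamma_abc (a b c : k) : {pred affine_group k} := fun g =>
  if c != 0 then (lin g == 1) && (E_poly a c (trans g) == 0)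
  else (lin g ^+ 5 == 1) && (E_poly a c (trans g) == b * (1 + lin g)).

Definition delta (a b c : k) g : kAS ch2 :=
  AS_class ch2 (a * trans g ^+ 5 + b * trans g ^+ 4 + c * trans g ^+ 3).

Definition ker_delta (a b c : k) : {pred affine_group k} := fun g =>
  (g \in Gamma_abc a b c) && (delta a b c g == 0).

Lemma NN_eq n n' : coef_a n = coef_a n' -> coef_b n = coef_b n' ->
  coef_c n = coef_c n' -> coef_d n = coef_d n' -> n = n'.
Proof.
case: n n' => [[[u b] c] d] [[[u' b'] c'] d'].
by rewrite /coef_a /coef_b /coef_c /coef_d /= => /val_inj -> -> -> ->.
Qed.

Lemma D2 (x y : k) : (x + y) ^+ 2 = x ^+ 2 + y ^+ 2.
Proof. by rewrite sqrrD mulr2n (addrr_pchar2 ch2) addr0. Qed.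

Lemma D4 (x y : k) : (x + y) ^+ 4 = x ^+ 4 + y ^+ 4.
Proof. by rewrite (exprM _ 2 2) !D2 -!exprM. Qed.

Lemma D8 (x y : k) : (x + y) ^+ 8 = x ^+ 8 + y ^+ 8.
Proof. by rewrite (exprM _ 2 4) D2 D4 -!exprM. Qed.

Lemma D16 (x y : k) : (x + y) ^+ 16 = x ^+ 16 + y ^+ 16.
Proof. by rewrite (exprM _ 2 8) D2 D8 -!exprM. Qed.

Lemma E_polyD (a c x y : k) : E_poly a c (x + y) = E_poly a c x + E_poly a c y.
Proof. by rewrite /E_poly D16 D8 D2; ring. Qed.

Lemma cocycle (a b c x y : k) :
  AS_class ch2 (a * (x + y) ^+ 5 + b * (x + y) ^+ 4 + c * (x + y) ^+ 3)
  = AS_class ch2 (a * x ^+ 5 + b * x ^+ 4 + c * x ^+ 3)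
  + AS_class ch2 (a * y ^+ 5 + (b + E_poly a c x) * y ^+ 4 + c * y ^+ 3).
Proof.
pose q := a * x ^+ 4 * y + c * x ^+ 2 * y.
pose r := a ^+ 4 * x ^+ 16 * y ^+ 4 + c ^+ 4 * x ^+ 8 * y ^+ 4
  + c ^+ 2 * x ^+ 2 * y ^+ 4.
rewrite -AS_classD.
have -> : a * (x + y) ^+ 5 + b * (x + y) ^+ 4 + c * (x + y) ^+ 3
  = (a * x ^+ 5 + b * x ^+ 4 + c * x ^+ 3 +
      (a * y ^+ 5 + (b + E_poly a c x) * y ^+ 4 + c * y ^+ 3))
    + (q ^+ 2) ^+ 2 + q + ((c * x * y ^+ 2) ^+ 2 + c * x * y ^+ 2).
  have r0 : 2%:R * r = 0 by rewrite (two0 ch2) mul0r.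
  have -> : (x + y) ^+ 5 = (x ^+ 4 + y ^+ 4) * (x + y) by rewrite -D4 -exprSr.
  have -> : (x + y) ^+ 3 = (x ^+ 2 + y ^+ 2) * (x + y) by rewrite -D2 -exprSr.
  by rewrite D4 -[LHS]addr0 -r0 /E_poly /q !D2 -?exprM /r; ring.
rewrite !AS_classD !AS_class_sq.
have z u : AS_class ch2 u + AS_class ch2 u = 0.
  by rewrite -[X in X + _]AS_classN addNr.
have qE : AS_class ch2 (a * x ^+ 4 * y) + AS_class ch2 (c * x ^+ 2 * y)
  = AS_class ch2 q by rewrite -AS_classD.
by rewrite -!addrA !(z, addr0) ?qE !(z, addr0).
Qed.

Lemma act1 n : act n 1%g = n.
Proof.
apply: NN_eq; rewrite /act /coef_a /coef_b /coef_c /coef_d /= ?lin1 ?trans1.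
- by rewrite expr1n mul1r.
- by rewrite /E_poly !expr0n /= !mulr0 !addr0 expr1n mul1r.
- by rewrite expr1n mul1r.
- by rewrite !expr0n /= !mulr0 !addr0 AS_class0 add0r.
Qed.

Lemma actM n g h : act n (g * h)%g = act (act n g) h.
Proof.
have aE m l : coef_a (act m l) = lin l ^+ 5 * coef_a m by [].
have bE m l : coef_b (act m l)
  = lin l ^+ 4 * (coef_b m + E_poly (coef_a m) (coef_c m) (trans l)) by [].
have cE m l : coef_c (act m l) = lin l ^+ 3 * coef_c m by [].
have dE m l : coef_d (act m l) = AS_class ch2 (coef_a m * trans l ^+ 5
  + coef_b m * trans l ^+ 4 + coef_c m * trans l ^+ 3) + coef_d m by [].
apply: NN_eq.
- by rewrite !aE linM; ring.
- by rewrite !(aE, bE, cE) linM transM E_polyD /E_poly; ring.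
- by rewrite !cE linM; ring.
rewrite !(aE, bE, cE, dE) transM [lin g * trans h + _]addrC cocycle.
rewrite -addrA; rewrite [LHS]addrCA; congr (_ + _).
by congr AS_class; ring.
Qed.

Lemma Gamma_abcP (a b c : k) g : reflect
  (if c != 0 then lin g = 1 /\ E_poly a c (trans g) = 0
   else lin g ^+ 5 = 1 /\ E_poly a c (trans g) = b * (1 + lin g))
  (g \in Gamma_abc a b c).
Proof.
rewrite unfold_in; case: (c != 0).
  by apply: (iffP andP) => -[/eqP ? /eqP ?].
by apply: (iffP andP) => -[/eqP ? /eqP ?].
Qed.

Lemma group_closed_Gamma_abc (a b c : k) : group_closed (Gamma_abc a b c).
Proof.
have E0 : E_poly a c 0 = 0 by rewrite /E_poly !expr0n /= !mulr0 !addr0.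
have z (x : k) : x + x = 0 := addrr_pchar2 ch2 x.
have EZ l x : c = 0 -> l ^+ 5 = 1 -> E_poly a c (l * x) = l * E_poly a c x.
  move=> c0 l5; rewrite /E_poly c0 !expr0n /= !mul0r !addr0 mulrDr !exprMn.
  have -> : l ^+ 16 = l by rewrite (exprD l 15 1) (exprM l 5 3) l5 expr1n mul1r.
  by ring.
have cl1 : 1%g \in Gamma_abc a b c.
  apply/Gamma_abcP; rewrite lin1 trans1 E0 z mulr0 expr1n.
  by case: (c != 0).
split=> // g h /Gamma_abcP Hg /Gamma_abcP Hh; apply/Gamma_abcP.
have -> : lin (g / h)%g = lin g / lin h by [].
have -> : trans (g / h)%g = trans g + lin g / lin h * trans h.
  by rewrite transM [trans (h^-1)%g]/trans /= mulrN (oppr_pchar2 ch2) addrC mulrA.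
case: eqP Hg Hh => /= [c0|_] [lg Eg] [lh Eh]; last first.
  by rewrite lg lh E_polyD divr1 mul1r Eg Eh addr0.
have l5 : (lin g / lin h) ^+ 5 = 1 by rewrite expr_div_n lg lh divr1.
split=> //; rewrite E_polyD EZ // Eg Eh.
have hK : lin g / lin h * lin h = lin g by rewrite divfK ?lin_neq0.
rewrite -[in 1 + lin g]hK; set t := lin g / lin h.
transitivity (b * (1 + t) + (b * (t * lin h) + b * (t * lin h))); first by ring.
by rewrite z addr0.
Qed.

Lemma deltaM (a b c : k) :
  {in Gamma_abc a b c &, forall g h,
     delta a b c (g * h)%g = delta a b c g + delta a b c h}.
Proof.
move=> g h /Gamma_abcP Hg _; have z (x : k) : x + x = 0 := addrr_pchar2 ch2 x.
rewrite /delta transM [lin g * trans h + _]addrC cocycle.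
congr (_ + _); congr AS_class.
case: eqP Hg => /= [c0|_] [lg Eg].
  rewrite Eg c0 !mul0r !addr0; set l := lin g in lg *.
  have -> : b + b * (1 + l) = b * l by rewrite mulrDr mulr1 addrA z add0r.
  by rewrite !exprMn lg mul1r -mulrA [l * _]mulrA -exprS lg mul1r.
by rewrite lg mul1r Eg addr0.
Qed.

End Action.

(* A curve y^2 + y = a x^5 + b x^4 + c x^3 + d with a chosen constant term d in
   k, as opposed to a class modulo AS(k). *)
Record curve (k : fieldType) := Curve {
  cv_a : nonzero k; cv_b : k; cv_c : k; cv_d : k }.

Definition curve_class (k : fieldType) (ch2 : 2%N \in [pchar k])
    (C : curve k) : NN ch2 :=
  (cv_a C, cv_b C, cv_c C, AS_class ch2 (cv_d C)).

Lemma curve_class_onto (k : fieldType) (ch2 : 2%N \in [pchar k])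
    (n : NN ch2) : exists C, curve_class ch2 C = n.
Proof.
exists (Curve n.1.1.1 (coef_b n) (coef_c n) (repr (coef_d n))).
by apply: NN_eq => //; exact: AS_classK.
Qed.

(* The smooth projective model of the curve is the curve
     Y^2 + Y Z^3 = a X^5 Z + b X^4 Z^2 + c X^3 Z^3 + d Z^6
   in the weighted projective plane P(1,3,1), whose coordinates X, Y, Z are
   indexed by 0, 1, 2; here x = X/Z and y = Y/Z^3. Varieties and morphisms over
   the perfect field k are taken in the classical sense: a variety is its set
   of points over an algebraic closure K of k, and a k-morphism is a map that
   near every point is given by polynomials with coefficients in k. *)
Definition wt (i : 'I_3) : nat := if i == 1 :> nat then 3 else 1.

Definition weight (m : 'X_{1..3}) : nat := (\sum_(i < 3) wt i * m i)%N.

Lemma weight0 : weight 0%MM = 0%N.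
Proof. by rewrite /weight big1 // => i _; rewrite mnm0E muln0. Qed.

Lemma weightD : {morph weight : m1 m2 / (m1 + m2)%MM >-> (m1 + m2)%N}.
Proof.
move=> m1 m2; rewrite /weight -big_split /=.
by apply: eq_bigr => i _; rewrite mnmDE mulnDr.
Qed.

HB.instance Definition _ := isMeasure.Build 3 weight weight0 weightD.

Definition weqv (K : fieldType) (u v : 'I_3 -> K) : Prop :=
  exists2 t : K, t != 0 & forall i, u i = t ^+ wt i * v i.

Definition triple (K : Type) (x y z : K) : 'I_3 -> K := tnth [tuple x; y; z].

Section Curves.
Variables (k : fieldType) (K : closedFieldType) (iota : {rmorphism k -> K}).
Implicit Types C : curve k.

Definition curve_rhs C (x : K) : K :=
  iota (val (cv_a C)) * x ^+ 5 + iota (cv_b C) * x ^+ 4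
  + iota (cv_c C) * x ^+ 3 + iota (cv_d C).

(* Y = 0 on the curve when Z = 0, so (1 : 0 : 0) is the only point at infinity. *)
Inductive point C : Type :=
| Affine (x y : K) of y ^+ 2 + y == curve_rhs C x
| Infinity.

Definition coords C (P : point C) : 'I_3 -> K :=
  match P with
  | Affine x y _ => triple x y 1
  | Infinity => triple 1 0 0
  end.

Definition curve_eqn C : {mpoly k[3]} :=
  let X := 'X_0 in let Y := 'X_1 in let Z := 'X_ord_max in
  Y ^+ 2 + Y * Z ^+ 3
  - ((val (cv_a C))%:MP * X ^+ 5 * Z + (cv_b C)%:MP * X ^+ 4 * Z ^+ 2
     + (cv_c C)%:MP * X ^+ 3 * Z ^+ 3 + (cv_d C)%:MP * Z ^+ 6).

Definition poly_map := 'I_3 -> {mpoly k[3]}.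

Definition wformed (d : nat) (F : poly_map) : Prop :=
  forall i, F i \is (d * wt i)%N.-homog for weight.

Definition peval (F : poly_map) (v : 'I_3 -> K) : 'I_3 -> K :=
  fun i => mmap iota v (F i).

(* Only the nonvanishing locus of F matters: it can be shrunk to any smaller
   open set by multiplying F 0, F 1, F 2 by s, s^3, s. *)
Definition given_by C C' (F : poly_map) (phi : point C -> point C') : Prop :=
  forall Q, (exists i, peval F (coords Q) i != 0) ->
    weqv (peval F (coords Q)) (coords (phi Q)).

Definition is_morphism C C' (phi : point C -> point C') : Prop :=
  forall P : point C, exists d F, [/\ wformed d F,
    exists i, peval F (coords P) i != 0 & given_by F phi].

Record isom C C' := Isom {
  fwd : point C -> point C';
  bwd : point C' -> point C;
  fwdK : cancel fwd bwd;
  bwdK : cancel bwd fwd;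
  fwd_morph : is_morphism fwd;
  bwd_morph : is_morphism bwd }.

Definition isomorphic C C' : Prop := inhabited (isom C C').

Lemma isom_eq C C' (f g : isom C C') : fwd f =1 fwd g -> f = g.
Proof.
case: f g => f1 f2 fK f2K fm f2m [g1 g2 gK g2K gm g2m] /= fg.
have e1 : f1 = g1 by apply: funext.
subst g1; have e2 : f2 = g2.
  by apply: funext => x; rewrite -{1}(g2K x) fK.
by subst g2; congr Isom; exact: Prop_irrelevance.
Qed.

Lemma mmap_scale (f : {mpoly k[3]}) d (t : K) (u v : 'I_3 -> K) :
  f \is d.-homog for weight -> (forall i, u i = t ^+ wt i * v i) ->
  mmap iota u f = t ^+ d * mmap iota v f.
Proof.
move=> /dhomogP hf uv; rewrite /mmap mulr_sumr; apply: eq_big_seq => m mf.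
rewrite mulrCA; congr (_ * _); rewrite -(hf m mf) /mmap1 /= /weight.
rewrite expr_sum -big_split /=; apply: eq_bigr => i _.
by rewrite uv exprMn -exprM.
Qed.

Definition poly_comp (G F : poly_map) : poly_map :=
  fun i => mmap (@mpolyC 3 k) F (G i).

Lemma wformed_comp d e F G :
  wformed d F -> wformed e G -> wformed (d * e) (poly_comp G F).
Proof.
move=> hF hG i; rewrite /poly_comp /mmap big_seq; apply: rpred_sum => m mG.
rewrite mul_mpolyC; apply: rpredZ; rewrite /mmap1.
have -> : (d * e * wt i = \sum_(j < 3) d * wt j * m j)%N.
  rewrite -mulnA -(dhomogP _ _ _ (hG i) m mG) /weight /= big_distrr /=.
  by apply: eq_bigr => j _; rewrite mulnA.
elim/big_rec2: _ => [|j x y _ hy]; first exact: dhomog1.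
by apply: dhomogM => //; apply: dhomogMn.
Qed.

Lemma peval_comp G F v : peval (poly_comp G F) v =1 peval G (peval F v).
Proof.
move=> i; rewrite /peval /poly_comp [X in mmap _ _ X]/mmap raddf_sum [RHS]/mmap.
apply: eq_bigr => m _; rewrite /= rmorphM /= mmapC; congr (_ * _).
by rewrite /mmap1 rmorph_prod; apply: eq_bigr => j _; rewrite rmorphXn.
Qed.

Lemma weqv_sym (u v : 'I_3 -> K) : weqv u v -> weqv v u.
Proof.
case=> t t0 uv; exists t^-1; first by rewrite invr_eq0.
by move=> i; rewrite uv mulrA -exprMn mulVf // expr1n mul1r.
Qed.

Lemma weqv_trans (u v w : 'I_3 -> K) : weqv u v -> weqv v w -> weqv u w.
Proof.
case=> t t0 uv [s s0 vw]; exists (t * s); first by rewrite mulf_neq0.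
by move=> i; rewrite uv vw mulrA exprMn.
Qed.

Lemma coords_neq0 C (P : point C) : exists i, coords P i != 0.
Proof.
by case: P => [x y h|]; [exists ord_max|exists ord0]; rewrite /= oner_neq0.
Qed.

Lemma id_morphism C : is_morphism (@id (point C)).
Proof.
move=> P; exists 1%N, (fun i => 'X_i); split.
- by move=> i; rewrite dhomogX /= /weight mul1n (bigD1 i) //= mnm1E eqxx muln1 big1 ?addn0 // => j ji; rewrite mnm1E eq_sym (negbTE ji) muln0.
- case: P => [x y h|]; [exists ord_max| exists ord0]; by rewrite /peval mmapX mmap1U /= oner_neq0.
- move=> Q _; exists 1; first exact: oner_neq0.
  by move=> i; rewrite expr1n mul1r /peval mmapX mmap1U.
Qed.

Lemma comp_morphism C1 C2 C3 (phi : point C1 -> point C2)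
    (psi : point C2 -> point C3) :
  is_morphism phi -> is_morphism psi -> is_morphism (psi \o phi).
Proof.
move=> hphi hpsi P.
have [d [F [hF F0 Fphi]]] := hphi P.
have [e [G [hG G0 Gpsi]]] := hpsi (phi P).
have wt_gt0 j : (0 < wt j)%N by rewrite /wt; case: ifP.
have scale t u v : (forall i, u i = t ^+ wt i * v i) ->
    forall i, peval G u i = (t ^+ e) ^+ wt i * peval G v i.
  by move=> uv i; rewrite /peval (mmap_scale (hG i) uv) exprM.
exists (d * e)%N, (poly_comp G F); split; first exact: wformed_comp.
  case: (Fphi P F0) => t t0 ht; case: G0 => i Gi; exists i.
  by rewrite peval_comp (scale _ _ _ ht) mulf_neq0 // !expf_neq0.
move=> Q [i]; rewrite peval_comp => nz.
(* if all F j vanish at Q then G is constant *)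
have [t ht] : exists t, forall j,
    peval F (coords Q) j = t ^+ wt j * coords (phi Q) j.
  have [Q0|Q0] := pselect (exists j, peval F (coords Q) j != 0).
    by case: (Fphi Q Q0) => t _ ht; exists t.
  exists 0 => j; rewrite expr0n eqn0Ngt wt_gt0 mul0r.
  by apply/eqP/negbNE/negP => nj; apply: Q0; exists j.
have hs := scale _ _ _ ht.
move: nz; rewrite hs mulf_eq0 negb_or expf_eq0 wt_gt0 /= => /andP[te0 nG].
apply: weqv_trans (Gpsi (phi Q) _); last by exists i.
by exists (t ^+ e) => // j; rewrite peval_comp hs.
Qed.

Definition isom_id C : isom C C :=
  Isom (fun=> erefl) (fun=> erefl) (@id_morphism C) (@id_morphism C).

Definition isom_inv C C' (f : isom C C') : isom C' C :=
  Isom (bwdK f) (fwdK f) (bwd_morph f) (fwd_morph f).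

Definition isom_comp C1 C2 C3 (g : isom C2 C3) (f : isom C1 C2) : isom C1 C3 :=
  Isom (can_comp (fwdK g) (fwdK f)) (can_comp (bwdK f) (bwdK g))
    (comp_morphism (fwd_morph f) (fwd_morph g))
    (comp_morphism (bwd_morph g) (bwd_morph f)).

Lemma mmap_curve_eqn C (u : 'I_3 -> K) :
  let X := u ord0 in let Y := u 1 in let Z := u ord_max in
  mmap iota u (curve_eqn C) = Y ^+ 2 + Y * Z ^+ 3
    - (iota (val (cv_a C)) * X ^+ 5 * Z + iota (cv_b C) * X ^+ 4 * Z ^+ 2
       + iota (cv_c C) * X ^+ 3 * Z ^+ 3 + iota (cv_d C) * Z ^+ 6).
Proof.
rewrite /curve_eqn /=; do ![rewrite ?(mmapX, mmapC, mmap1U) /=;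
  rewrite (rmorphB, rmorphD, rmorphM, rmorphXn) /=].
by rewrite !(mmapX, mmapC, mmap1U).
Qed.

Lemma coords_eqn C (P : point C) : mmap iota (coords P) (curve_eqn C) = 0.
Proof.
rewrite mmap_curve_eqn; case: P => [x y h|]; rewrite /= /triple /=.
  by rewrite !(tnth_nth 0) /= !expr1n !mulr1; apply/eqP; rewrite subr_eq0.
by rewrite !(tnth_nth 0) /= !expr0n /= !mulr0 !addr0 ?mul0r subrr.
Qed.

Lemma affine_eq C (x y x' y' : K) (h : y ^+ 2 + y == curve_rhs C x)
    (h' : y' ^+ 2 + y' == curve_rhs C x') :
  x = x' -> y = y' -> Affine h = Affine h'.
Proof. by move=> e f; subst; congr Affine; exact: eq_irrelevance. Qed.

Lemma coords_inj C (P Q : point C) : weqv (coords P) (coords Q) -> P = Q.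
Proof.
case: P Q => [x y h|] [x' y' h'|] //= -[t t0 e].
- move: (e ord_max) (e 1) (e ord0).
  rewrite /triple !(tnth_nth 0) /= mulr1 expr1 => <-.
  by rewrite !expr1n !mul1r => ey ex; apply: affine_eq.
- by move: (e ord_max) => /eqP; rewrite /triple !(tnth_nth 0) /= mulr0 oner_eq0.
- move: (e ord_max) => /eqP; rewrite /triple !(tnth_nth 0) /= mulr1 expr1 eq_sym.
  by rewrite (negbTE t0).
Qed.

(* Every nonzero solution of the weighted homogeneous equation represents
   exactly one point. *)
Lemma coordsP C (u : 'I_3 -> K) :
  (exists i, u i != 0) -> mmap iota u (curve_eqn C) = 0 ->
  exists! P : point C, weqv u (coords P).
Proof.
move=> u0; rewrite mmap_curve_eqn /= => eqn.
suff [P hP] : exists P : point C, weqv u (coords P).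
  exists P; split=> // Q hQ; apply: coords_inj.
  exact: weqv_trans (weqv_sym hP) hQ.
have ordP (Pr : 'I_3 -> Prop) : Pr ord0 -> Pr 1 -> Pr ord_max -> forall i, Pr i.
  move=> p0 p1 p2 [[|[|[|//]]] hi].
  - by have -> : Ordinal hi = ord0 by apply: val_inj.
  - by have -> : Ordinal hi = 1 by apply: val_inj.
  - by have -> : Ordinal hi = ord_max by apply: val_inj.
have [Z0|Z0] := eqVneq (u ord_max) 0.
  have Y0 : u 1 = 0.
    move: eqn; rewrite Z0 !expr0n /= !mulr0 !addr0 subr0 => /eqP.
    by rewrite sqrf_eq0 => /eqP.
  exists (Infinity C); exists (u ord0).
    apply/negP => /eqP X0; case: u0; apply: ordP; by rewrite ?X0 ?Y0 ?Z0 eqxx.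
  apply: ordP; rewrite /= /triple !(tnth_nth 0) /= ?mulr0 //.
  by rewrite mulr1.
have h : (u 1 / u ord_max ^+ 3) ^+ 2 + u 1 / u ord_max ^+ 3
         == curve_rhs C (u ord0 / u ord_max).
  rewrite -subr_eq0; apply/eqP.
  transitivity (0 / u ord_max ^+ 6); last by rewrite mul0r.
  by rewrite -eqn /curve_rhs; field.
exists (Affine h); exists (u ord_max) => //.
apply: ordP; rewrite /= /triple !(tnth_nth 0) /= ?expr1 ?mulr1 //.
  by rewrite mulrC divfK.
by rewrite mulrC divfK // expf_neq0.
Qed.

(* The multiplicative group acts freely on triples with X or Z nonzero, so
   smoothness of the curve is that of its cone away from the origin. *)
Lemma curve_smooth (ch2 : 2%N \in [pchar k]) C (P : point C) :
  exists i, mmap iota (coords P) (curve_eqn C)^`M(i) != 0.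
Proof.
have dX (i j : 'I_3) : ('X_i : {mpoly k[3]})^`M(j) = (i == j)%:R.
  rewrite mderivX mnm1E; case: eqP => [->|_]; last by rewrite scale0r.
  rewrite scale1r (_ : (U_(j) - U_(j))%MM = 0%MM) ?mpolyX0 //.
  by apply/mnmP => l; rewrite mnmBE subnn mnm0E.
have ch2K : 2%N \in [pchar K] := rmorph_pchar iota ch2.
have z (x : K) : x + x = 0 := addrr_pchar2 ch2K x.
case: P => [x y h|]; [exists 1 | exists ord_max];
  rewrite /curve_eqn !exprS !expr0;
  rewrite !(mderivB, mderivD, mderivM, mderivC, dX, mpolyC0) /=;
  rewrite !(mul0r, mulr0, addr0, add0r, mul1r, mulr1, mderivC, subr0).
  rewrite !(rmorphD, rmorphM) /= !mmapX !mmap1U /triple !(tnth_nth 0) /=.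
  by rewrite z add0r !mulr1 oner_neq0.
rewrite !(rmorphB, rmorphD, rmorphM) /= ?mmapC !mmapX !mmap1U /triple !(tnth_nth 0) /=.
rewrite !(mul0r, mulr0, mul1r, mulr1, addr0, sub0r) oppr_eq0.
by rewrite fmorph_eq0 (valP (cv_a C)).
Qed.

End Curves.

Definition Aut (k : fieldType) (K : closedFieldType) (iota : {rmorphism k -> K})
  (C : curve k) := isom iota C C.

Section AutGroup.
Variables (k : fieldType) (K : closedFieldType) (iota : {rmorphism k -> K}).
Variable C : curve k.

HB.instance Definition _ := gen_eqMixin (Aut iota C).
HB.instance Definition _ := gen_choiceMixin (Aut iota C).

Lemma aut_mulA : associative (@isom_comp _ _ iota C C C).
Proof. by move=> f g h; apply: isom_eq. Qed.
Lemma aut_mul1g : left_id (isom_id iota C) (@isom_comp _ _ iota C C C).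
Proof. by move=> f; apply: isom_eq. Qed.
Lemma aut_mulg1 : right_id (isom_id iota C) (@isom_comp _ _ iota C C C).
Proof. by move=> f; apply: isom_eq. Qed.
Lemma aut_mulVg : left_inverse (isom_id iota C) (@isom_inv _ _ iota C C)
  (@isom_comp _ _ iota C C C).
Proof. by move=> f; apply: isom_eq => x /=; rewrite fwdK. Qed.
Lemma aut_mulgV : right_inverse (isom_id iota C) (@isom_inv _ _ iota C C)
  (@isom_comp _ _ iota C C C).
Proof. by move=> f; apply: isom_eq => x /=; rewrite bwdK. Qed.

HB.instance Definition _ := isGroup.Build (Aut iota C)
  aut_mulA aut_mul1g aut_mulg1 aut_mulVg aut_mulgV.
End AutGroup.


Section Hyperelliptic.
Variables (k : fieldType) (ch2 : 2%N \in [pchar k]).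
Variables (K : closedFieldType) (iota : {rmorphism k -> K}) (C : curve k).

Lemma hyp_subproof (x y : K) : y ^+ 2 + y == curve_rhs iota C x ->
  (y + 1) ^+ 2 + (y + 1) == curve_rhs iota C x.
Proof.
have ch2K : 2%N \in [pchar K] := rmorph_pchar iota ch2.
move/eqP <-; rewrite (D2 ch2K) expr1n addrACA.
by rewrite (addrr_pchar2 ch2K) addr0.
Qed.

Definition hyp_fun (P : point iota C) : point iota C :=
  match P with
  | Affine x y h => Affine (hyp_subproof h)
  | Infinity => Infinity iota C
  end.

Lemma hyp_funK : involutive hyp_fun.
Proof.
have ch2K : 2%N \in [pchar K] := rmorph_pchar iota ch2.
case=> [x y h|] //=; apply: affine_eq => //.
by rewrite -addrA (addrr_pchar2 ch2K) addr0.
Qed.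

Lemma hyp_morphism : is_morphism hyp_fun.
Proof.
pose F : poly_map k :=
  triple 'X_0 ('X_1 + 'X_ord_max ^+ 3) 'X_ord_max.
have hX i : ('X_i : {mpoly k[3]}) \is (wt i).-homog for weight.
  rewrite dhomogX /= /weight (bigD1 i) //= mnm1E eqxx muln1 big1 ?addn0 //.
  by move=> j ji; rewrite mnm1E eq_sym (negbTE ji) muln0.
have FE P : peval iota F (coords P) =1 coords (hyp_fun P).
  case=> -[|[|[|//]]] hi; rewrite /peval /F {1}/triple (tnth_nth 0) /=.
  - by rewrite mmapX mmap1U; case: P.
  - rewrite rmorphD rmorphXn /= !mmapX !mmap1U.
    case: P => [x y h|]; rewrite /= /triple !(tnth_nth 0) /= ?expr1n //.
    by rewrite expr0n addr0.
  - by rewrite mmapX mmap1U; case: P.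
move=> P; exists 1%N, F; split.
- have homE i : F i = 'X_i -> F i \is (1 * wt i)%N.-homog for weight.
    by move=> ->; rewrite mul1n.
  case=> -[|[|[|//]]] hi.
  + by apply: homE; rewrite /F /triple (tnth_nth 0) /=; congr ('X_[U_(_)]); apply: val_inj.
  + rewrite /F /triple (tnth_nth 0) /=; apply: dhomogD; first exact: (hX 1).
    exact: (dhomogMn 3 (hX ord_max)).
  + by apply: homE; rewrite /F /triple (tnth_nth 0) /=; congr ('X_[U_(_)]); apply: val_inj.
- by have [i hi] := coords_neq0 (hyp_fun P); exists i; rewrite FE.
- move=> Q _; exists 1; first exact: oner_neq0.
  by move=> i; rewrite expr1n mul1r FE.
Qed.

Definition hyp_inv : Aut iota C := Isom hyp_funK hyp_funK hyp_morphism hyp_morphism.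

(* (x, y) |-> (g x, y + v x) with v = p / q in k(x); the finitely many poles of
   v, and the point at infinity, are left out. *)
Definition induces (phi : point iota C -> point iota C)
    (g : affine_group k) : Prop :=
  exists p q : {poly k}, q != 0 /\
    forall (x y : K) (h : y ^+ 2 + y == curve_rhs iota C x),
      (map_poly iota q).[x] != 0 ->
      exists h', phi (Affine h) =
        @Affine k K iota C (iota (lin g) * x + iota (trans g))
          (y + (map_poly iota p).[x] / (map_poly iota q).[x]) h'.

End Hyperelliptic.

Definition in_cyclic_subgroup (G : groupType) (x y : G) : Prop :=
  exists n : nat, (y = x ^+ n)%g \/ (y = x ^- n)%g.

(* Main.v *)
Require Import Defs.
From HB Require Import structures.
From mathcomp Require Import all_boot all_order all_algebra all_field.
From mathcomp Require Import mpoly ring zify boolp.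
Set Implicit Arguments.
Unset Strict Implicit.
Unset Printing Implicit Defensive.
Import GRing.Theory.
Local Open Scope ring_scope.

(* Functions on the affine curve are written A + B y with A, B in k[x]; their
   degree as poles at infinity is that of the norm A^2 - A B - B^2 f, where x
   has degree 2 and y degree 5.

   An isomorphism phi from C : y^2 + y = f to C' : y^2 + y = f' fixes infinity.
   Otherwise phi(infinity) = (x0, y0) is affine, and h = x o phi^-1 is regular on
   C' except for a double pole at (x0, y0). Then (x - x0)^2 h is regular on the
   affine curve, of degree at most 4, hence a polynomial in x of degree at most
   2; as h is regular at (x0, y0 + 1), this polynomial is a multiple of
   (x - x0)^2, so h is constant, which is absurd.

   Hence phi pulls x and y back to affine functions u and w. From
   w^2 + w = f'(u) we get 2 deg w = 5 deg u, and since x is a polynomial in u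
   and w, deg u = 2 and deg w = 5. So u = l x + n and w = y + v(x) with
   deg v <= 2, and comparing coefficients of f'(l x + n) = v^2 + v + f gives the
   action of the affine group. *)

(** * Norms of functions on the affine curve and their degrees at infinity *)

Section QuadraticNorm.
Variables (k : fieldType) (f : {poly k}).
Hypothesis f6 : size f = 6%N.
Implicit Types p q : {poly k} * {poly k}.

(* The pair (A, B) stands for A + B y in k[x][y] / (y^2 + y - f). *)
Definition qmul p q : {poly k} * {poly k} :=
  (p.1 * q.1 + p.2 * q.2 * f, p.1 * q.2 + p.2 * q.1 - p.2 * q.2).

Definition qnorm p : {poly k} := p.1 ^+ 2 - p.1 * p.2 - p.2 ^+ 2 * f.

(** The conjugation sends y to -1 - y, the other root of y^2 + y = f; in characteristic two this is
    y + 1, the hyperelliptic involution. *)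
Definition qconj p : {poly k} * {poly k} := (p.1 - p.2, - p.2).

Lemma qnormM p q : qnorm (qmul p q) = qnorm p * qnorm q.
Proof. by rewrite /qnorm /qmul /=; ring. Qed.

Lemma qnormC (A : {poly k}) : qnorm (A, 0) = A ^+ 2.
Proof. by rewrite /qnorm /=; ring. Qed.

(* The two contributions have opposite parities, so they never cancel. *)
Lemma size_qnorm p : size (qnorm p) =
  maxn (2 * size p.1).-1 (if p.2 == 0 then 0%N else (2 * size p.2 + 4)%N).
Proof.
have f0 : f != 0 by rewrite -size_poly_gt0 f6.
case: p => A B /=; case: eqP => [->|/eqP B0].
  rewrite qnormC maxn0; have [->|A0] := eqVneq A 0.
    by rewrite expr0n size_poly0.
  by rewrite expr2 size_mul // mul2n addnn.
have sB : (0 < size B)%N by rewrite size_poly_gt0.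
have sBf : size (- (B ^+ 2 * f)) = (2 * size B + 4)%N.
  rewrite size_polyN size_mul ?expf_neq0 // expr2 size_mul // f6.
  by move: sB; set s := size B; lia.
have [->|A0] := eqVneq A 0.
  by rewrite /qnorm /= expr0n mul0r subr0 add0r sBf size_poly0 max0n.
have sA : (0 < size A)%N by rewrite size_poly_gt0.
have sA2 : size (A ^+ 2) = (2 * size A).-1.
  by rewrite expr2 size_mul // mul2n addnn.
have sAB : size (- (A * B)) = (size A + size B).-1.
  by rewrite size_polyN size_mul.
rewrite /qnorm /=; case: (ltngtP (2 * size A).-1 (2 * size B + 4)%N) => h.
- rewrite addrC size_polyDl ?sBf //.
  apply: leq_ltn_trans (size_polyD _ _) _; rewrite sA2 sAB gtn_max h /=.
  by move: h sA; set a := size A; set b := size B; lia.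
- rewrite -addrA size_polyDl ?sA2 //.
  apply: leq_ltn_trans (size_polyD _ _) _; rewrite sBf sAB gtn_max h andbT.
  by move: h sA sB; set a := size A; set b := size B; lia.
- by exfalso; lia.
Qed.

Lemma qnorm_eq0 p : (qnorm p == 0) = (p == 0).
Proof.
apply/idP/eqP => [|->]; last by rewrite /qnorm /=; apply/eqP; ring.
rewrite -size_poly_eq0 size_qnorm; case: p => A B /=.
have [->|B0] := eqVneq B 0; last by lia.
rewrite maxn0 => sA; have /eqP -> // : A == 0.
by rewrite -size_poly_eq0; move: sA; set a := size A; lia.
Qed.

Definition qdeg p : nat := (size (qnorm p)).-1.

Lemma qmul_neq0 p q : p != 0 -> q != 0 -> qmul p q != 0.
Proof. by rewrite -!(qnorm_eq0) qnormM; exact: mulf_neq0. Qed.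

Lemma qdegM p q : p != 0 -> q != 0 -> qdeg (qmul p q) = (qdeg p + qdeg q)%N.
Proof.
rewrite -!qnorm_eq0 /qdeg qnormM => p0 q0; rewrite size_mul //.
move: p0 q0; rewrite -!size_poly_gt0.
by set a := size (qnorm p); set b := size (qnorm q); lia.
Qed.

(** The norm is not additive, but by [size_qnorm] its size depends only on the sizes of the two
    components, and monotonically. This makes the degree at infinity ultrametric. *)
Lemma size_qnormD p q :
  (size (qnorm (p + q)%R) <= maxn (size (qnorm p)) (size (qnorm q)))%N.
Proof.
rewrite !size_qnorm; case: p q => [A B] [A' B'] /=.
have := size_polyD A A'; have := size_polyD B B'.
rewrite -(size_poly_eq0 (B + B')) -(size_poly_eq0 B) -(size_poly_eq0 B').
set a := size A; set a' := size A'; set b := size B; set b' := size B'.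
by set c := size (A + A'); set d := size (B + B'); repeat case: eqP; lia.
Qed.

Lemma size_qnormN p : size (qnorm (- p)) = size (qnorm p).
Proof. by rewrite !size_qnorm /= oppr_eq0 !size_polyN. Qed.

(** The ultrametric inequality is applied to p + q and to q = (p + q) - p. *)
Lemma qdegDr p q : (qdeg p < qdeg q)%N -> qdeg (p + q) = qdeg q.
Proof.
have := size_qnormD p q; have := size_qnormD (p + q) (- p).
rewrite addrAC subrr add0r size_qnormN /qdeg.
by set a := size (qnorm p); set b := size (qnorm q); set c := size _; lia.
Qed.

Lemma qdeg_eq0 p : qdeg p = 0%N -> exists c, p = (c%:P, 0).
Proof.
case: p => A B; rewrite /qdeg size_qnorm /=.
have [->|B0] := eqVneq B 0; last by lia.
rewrite maxn0 => sA; have /size1_polyC -> : (size A <= 1)%N.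
  by move: sA; set a := size A; lia.
by exists A`_0.
Qed.

Lemma qdegC c : qdeg (c%:P, 0) = 0%N.
Proof. by rewrite /qdeg size_qnorm /= eqxx size_polyC; case: (c != 0). Qed.

(** A nonzero y-part has a pole of order at least 5, the order of y itself. *)
Lemma qdeg_lt5 p : (qdeg p < 5)%N -> (size p.1 <= 3)%N /\ p.2 = 0.
Proof.
case: p => A B; rewrite /qdeg size_qnorm /= -size_poly_eq0.
set a := size A; set b := size B => h; case: eqP h => b0; last by lia.
by split; [lia | apply/eqP; rewrite -size_poly_eq0; apply/eqP].
Qed.

Lemma qdeg2 p : qdeg p = 2%N -> size p.1 = 2%N /\ p.2 = 0.
Proof.
move=> d2; have [] : (size p.1 <= 3)%N /\ p.2 = 0 by apply: qdeg_lt5; rewrite d2.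
case: p d2 => A B /= d2 sA B0; split=> //=.
by move: d2 sA; rewrite /qdeg size_qnorm /= B0 eqxx; set a := size A; lia.
Qed.

Lemma qdeg5 p : qdeg p = 5%N -> (size p.1 <= 3)%N /\ size p.2 = 1%N.
Proof.
case: p => A B; rewrite /qdeg size_qnorm /= -size_poly_eq0.
by set a := size A; set b := size B; case: eqP; lia.
Qed.

Lemma qdeg_neq0 p : (0 < qdeg p)%N -> p != 0.
Proof. by rewrite -qnorm_eq0 -size_poly_gt0 /qdeg; set a := size _; lia. Qed.

End QuadraticNorm.

(** * Functions on the affine curve *)

Section RegularFunctions.
Variables (k : fieldType) (K : closedFieldType) (iota : {rmorphism k -> K}).
Implicit Types (C : curve k) (A B : {poly k}) (p q : {poly k} * {poly k}).

Definition rhs_poly C : {poly k} :=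
  val (cv_a C) *: 'X^5 + cv_b C *: 'X^4 + cv_c C *: 'X^3 + (cv_d C)%:P.

Lemma size_rhs_poly C : size (rhs_poly C) = 6%N.
Proof.
have a0 := valP (cv_a C).
have sa : size (val (cv_a C) *: 'X^5 : {poly k}) = 6%N.
  by rewrite size_scale // size_polyXn.
rewrite /rhs_poly -!addrA size_polyDl ?sa //.
apply: leq_ltn_trans (size_polyD _ _) _; rewrite gtn_max.
rewrite (leq_ltn_trans (size_scale_leq _ _)) ?size_polyXn //=.
apply: leq_ltn_trans (size_polyD _ _) _; rewrite gtn_max.
rewrite (leq_ltn_trans (size_scale_leq _ _)) ?size_polyXn //=.
by apply: leq_ltn_trans (size_polyC_leq1 _) _.
Qed.

Definition ieval A (x : K) : K := (map_poly iota A).[x].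

Lemma ievalD A B x : ieval (A + B) x = ieval A x + ieval B x.
Proof. by rewrite /ieval rmorphD hornerD. Qed.
Lemma ievalN A x : ieval (- A) x = - ieval A x.
Proof. by rewrite /ieval rmorphN hornerN. Qed.
Lemma ievalM A B x : ieval (A * B) x = ieval A x * ieval B x.
Proof. by rewrite /ieval rmorphM hornerM. Qed.
Lemma ievalZ a A x : ieval (a *: A) x = iota a * ieval A x.
Proof. by rewrite /ieval linearZ hornerZ. Qed.
Lemma ievalXn A n x : ieval (A ^+ n) x = ieval A x ^+ n.
Proof. by rewrite /ieval rmorphXn horner_exp. Qed.
Lemma ievalC a x : ieval a%:P x = iota a.
Proof. by rewrite /ieval map_polyC hornerC. Qed.
Lemma ievalX x : ieval 'X x = x.
Proof. by rewrite /ieval map_polyX hornerX. Qed.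
Lemma ieval0 x : ieval 0 x = 0.
Proof. by rewrite /ieval rmorph0 horner0. Qed.
Lemma ieval1 x : ieval 1 x = 1.
Proof. by rewrite /ieval rmorph1 hornerC. Qed.
Lemma ieval_comp A B x : ieval (A \Po B) x = ieval A (ieval B x).
Proof. by rewrite /ieval map_comp_poly horner_comp. Qed.
Definition ievalE := (ievalD, ievalN, ievalM, ievalZ, ievalXn, ievalC, ievalX,
  ieval0, ieval1).

Lemma ieval_rhs C x : ieval (rhs_poly C) x = curve_rhs iota C x.
Proof. by rewrite /rhs_poly /curve_rhs !ievalE. Qed.

Lemma ieval_nonroot A : A != 0 -> exists x, ieval A x != 0.
Proof.
rewrite -(map_poly_eq0 iota) => /closed_nonrootP[x nx].
by exists x.
Qed.

Section Points.
Variable C : curve k.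
Local Notation f := (rhs_poly C).
Implicit Types P T : point iota C.

Definition affine P : bool := if P is Affine _ _ _ then true else false.
Definition px P : K := if P is Affine x _ _ then x else 0.
Definition py P : K := if P is Affine _ y _ then y else 0.

Lemma coords_affine P : affine P -> coords P = triple (px P) (py P) 1.
Proof. by case: P. Qed.

Lemma naffine P : ~~ affine P -> P = Infinity iota C.
Proof. by case: P. Qed.

Lemma py_eqn P : affine P -> py P ^+ 2 = ieval f (px P) - py P.
Proof. by case: P => //= x y /eqP h _; rewrite ieval_rhs -h addrK. Qed.

Lemma point_eq P T : affine P -> affine T -> px P = px T -> py P = py T -> P = T.
Proof. by case: P T => [x y h|] // [x' y' h'|] // _ _ /= *; exact: affine_eq. Qed.

Lemma point_above x : exists2 P, affine P & px P = x.
Proof.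
have [y] : exists y, root ('X^2 + 'X - (curve_rhs iota C x)%:P : {poly K}) y.
  apply/closed_rootP; rewrite -addrA size_polyDl size_polyXn //.
  apply: leq_ltn_trans (size_polyD _ _) _; rewrite size_polyX size_polyN gtn_max /=.
  exact: leq_ltn_trans (size_polyC_leq1 _) _.
rewrite /root !hornerE subr_eq0 => h.
by exists (Affine h).
Qed.

Definition qeval p P : K := ieval p.1 (px P) + ieval p.2 (px P) * py P.

Lemma qevalD p q P : qeval (p + q) P = qeval p P + qeval q P.
Proof. by rewrite /qeval /= !ievalE; ring. Qed.

Lemma qevalN p P : qeval (- p) P = - qeval p P.
Proof. by rewrite /qeval /= !ievalE; ring. Qed.

Lemma qevalC A P : qeval (A, 0) P = ieval A (px P).
Proof. by rewrite /qeval /= !ievalE; ring. Qed.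

Lemma qevalM p q P : affine P -> qeval (qmul f p q) P = qeval p P * qeval q P.
Proof.
move=> /py_eqn; rewrite /qeval /=; move: (rhs_poly C) => g e; rewrite !ievalE.
rewrite [RHS](_ : _ = ieval p.1 (px P) * ieval q.1 (px P)
  + (ieval p.1 (px P) * ieval q.2 (px P) + ieval p.2 (px P) * ieval q.1 (px P)) * py P
  + ieval p.2 (px P) * ieval q.2 (px P) * py P ^+ 2); last by ring.
by rewrite e; ring.
Qed.

Lemma qeval_norm p P : affine P ->
  ieval (qnorm f p) (px P) = qeval p P * qeval (qconj p) P.
Proof.
move=> aP; rewrite -qevalM // -qevalC; congr qeval.
by case: p => A B; rewrite /qmul /qnorm /qconj /=; congr pair; ring.
Qed.

(** For nonzero p the norm times S is a nonzero polynomial, so it is nonzero at some x. At a point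
    above this x the norm is a multiple of the value of p, which therefore cannot vanish. *)
Lemma qeval_inj p (S : {poly k}) : S != 0 ->
  (forall T, affine T -> ieval S (px T) != 0 -> qeval p T = 0) -> p = 0.
Proof.
move=> S0 h; apply/eqP; rewrite -(qnorm_eq0 (size_rhs_poly C)); apply/eqP.
apply/eqP; apply: contraT => N0.
have [x] := ieval_nonroot (mulf_neq0 N0 S0).
have [T aT <-] := point_above x.
by rewrite ievalM mulf_eq0 qeval_norm // => /norP[] /[swap] Sx; rewrite h // mul0r eqxx.
Qed.

Lemma qeval_inj_affine p q :
  (forall T, affine T -> qeval p T = qeval q T) -> p = q.
Proof.
move=> h; apply/eqP; rewrite -subr_eq0; apply/eqP.
apply: (@qeval_inj _ 1) => [|T aT _]; first exact: oner_neq0.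
by rewrite qevalD qevalN h // subrr.
Qed.

End Points.

Section Globalization.
Variables (ch2 : 2%N \in [pchar k]) (C : curve k).
Local Notation f := (rhs_poly C).
Implicit Types P T : point iota C.

Lemma affine_hyp P : affine (hyp_fun ch2 P) = affine P.
Proof. by case: P. Qed.

Lemma px_hyp P : px (hyp_fun ch2 P) = px P.
Proof. by case: P. Qed.

Lemma qeval_conj p P : affine P ->
  qeval (qconj p) P = qeval p (hyp_fun ch2 P).
Proof.
have ch2K : 2%N \in [pchar K] := rmorph_pchar iota ch2.
case: P => //= x y h _; rewrite /qeval /= !ievalE !(oppr_pchar2 ch2K).
by ring.
Qed.

(* The polynomials in x that are denominators of r form an ideal without
   zeros, because the norm of a denominator not vanishing at the two points
   above x does not vanish at x. *)
Lemma regular_everywhere (S : {poly k}) (r : point iota C -> K) : S != 0 ->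
  (forall P, affine P -> exists q p, qeval q P != 0 /\
     forall T, affine T -> ieval S (px T) != 0 -> qeval q T * r T = qeval p T) ->
  exists p, forall T, affine T -> ieval S (px T) != 0 -> r T = qeval p T.
Proof.
move=> S0 loc.
pose J q := exists p, forall T, affine T -> ieval S (px T) != 0 ->
  qeval q T * r T = qeval p T.
have JD q q' : J q -> J q' -> J (q + q').
  move=> [p hp] [p' hp']; exists (p + p') => T aT sT.
  by rewrite !qevalD mulrDl hp // hp'.
have JM q q' : J q -> J (qmul f q' q).
  move=> [p hp]; exists (qmul f q' p) => T aT sT.
  by rewrite !qevalM // -mulrA hp.
have JN q : J q -> J (qnorm f q, 0).
  move=> /(JM _ (qconj q))[p hp]; exists p => T aT sT.
  by rewrite -hp // qevalM // qevalC qeval_norm // [qeval _ T * qeval q T]mulrC.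
have nz x : exists2 N, J (N, 0) & ieval N x != 0.
  have [P aP <-] := point_above C x.
  suff [q Jq /andP[q1 q2]] :
      exists2 q, J q & (qeval q P != 0) && (qeval q (hyp_fun ch2 P) != 0).
    by exists (qnorm f q); [exact: JN | rewrite qeval_norm // mulf_neq0 // qeval_conj].
  have [q1 [p1 [n1 h1]]] := loc P aP.
  have [|q2 [p2 [n2 h2]]] := loc (hyp_fun ch2 P); first by rewrite affine_hyp.
  have J1 : J q1 by exists p1.
  have J2 : J q2 by exists p2.
  (* If each of the two denominators vanishes at the other's point, their sum vanishes at
     neither. *)
  have [z1|z1] := eqVneq (qeval q1 (hyp_fun ch2 P)) 0; last by exists q1; rewrite ?n1.
  have [z2|z2] := eqVneq (qeval q2 P) 0; last by exists q2; rewrite ?n2 ?z2.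
  by exists (q1 + q2); [exact: JD | rewrite !qevalD z1 z2 addr0 add0r n1 n2].
suff [p hp] : J (1, 0).
  by exists p => T aT sT; rewrite -hp // qevalC ieval1 mul1r.
have [N JN0 N0] := nz 0; have {}N0 : N != 0.
  by apply: contraNneq N0 => ->; rewrite ieval0.
(* Euclidean descent: a nonconstant N has a root x in K, and a denominator M with M(x) nonzero
   leaves a nonzero remainder modulo N, of smaller size. A nonzero constant denominator is
   invertible. *)
have [m] := ubnP (size N); elim: m N JN0 N0 => // m IH N JN0 N0 sN.
have [/eqP/size_poly1P[c c0 Nc]|sN1] := eqVneq (size N) 1%N.
  have := JM _ (c^-1%:P, 0) JN0; rewrite Nc /qmul /=.
  by rewrite !mul0r !mulr0 !addr0 subr0 -polyCM mulVf.
have [x] : exists x, root (map_poly iota N) x.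
  by apply/closed_rootP; rewrite size_map_poly.
have [M JM0 Mx] := nz x => rNx.
have rNM : ieval (M %% N) x = ieval M x.
  by rewrite [in RHS](divp_eq M N) !ievalE /ieval (rootP rNx) mulr0 add0r.
apply: (IH (M %% N)); last 1 first.
- by rewrite -ltnS (leq_trans _ sN) // ltnS ltn_modp.
- suff -> : (M %% N, 0) = (M, 0) + qmul f (- (M %/ N), 0) (N, 0) by apply/JD/JM.
  rewrite /qmul /= !mul0r !mulr0 subr0 !addr0; congr pair => /=; last by rewrite addr0.
  by rewrite mulNr [X in _ = X - _](divp_eq M N) addrAC subrr add0r.
- by apply: contraNneq Mx => e; rewrite -rNM e ieval0.
Qed.

End Globalization.
End RegularFunctions.

(** * Behaviour at infinity *)

Lemma ord3_ind (Pr : 'I_3 -> Prop) :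
  Pr ord0 -> Pr 1 -> Pr ord_max -> forall i, Pr i.
Proof.
move=> p0 p1 p2 [[|[|[|//]]] hi].
- by have -> : Ordinal hi = ord0 by apply: val_inj.
- by have -> : Ordinal hi = 1 by apply: val_inj.
- by have -> : Ordinal hi = ord_max by apply: val_inj.
Qed.

Section WeightFiltration.
Variables (k : fieldType) (K : closedFieldType) (iota : {rmorphism k -> K}).
Variable C : curve k.
Local Notation f := (rhs_poly C).
Implicit Types (P T : point iota C) (h : point iota C -> K).

(* A form of weight e restricts to a function with a pole of order at most 2e at
   infinity; c is its value at (1 : 0 : 0). *)
Definition graded (e : nat) (c : K) h := exists p : {poly k} * {poly k},
  [/\ (size p.1 <= e.+1)%N, (size p.2 <= e - 2)%N, iota p.1`_e = c
    & forall T, affine T -> h T = qeval p T].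

Lemma eq_graded e c c' h h' : graded e c h -> c = c' ->
  (forall T, affine T -> h T = h' T) -> graded e c' h'.
Proof.
move=> [p [p1 p2 pe hp]] <- hh; exists p; split=> // T aT.
by rewrite -hp // hh.
Qed.

Lemma gradedC (a : k) : graded 0 (iota a) (fun=> iota a).
Proof.
exists (a%:P, 0); split=> [||| T _]; rewrite ?qevalC ?ievalC ?coefC ?size_poly0 //.
exact: size_polyC_leq1.
Qed.

Lemma gradedD e c c' h h' : graded e c h -> graded e c' h' ->
  graded e (c + c') (fun T => h T + h' T).
Proof.
move=> [p [p1 p2 pe hp]] [q [q1 q2 qe hq]]; exists (p + q); split=> [||| T aT] /=.
- by rewrite (leq_trans (size_polyD _ _)) // geq_max p1.
- by rewrite (leq_trans (size_polyD _ _)) // geq_max p2.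
- by rewrite coefD rmorphD pe qe.
- by rewrite qevalD hp // hq.
Qed.

Lemma graded0 e : graded e 0 (fun=> 0).
Proof.
exists 0; split=> [||| T aT] /=; rewrite ?size_poly0 ?coef0 ?rmorph0 //.
by rewrite /qeval !ieval0 mul0r addr0.
Qed.

Lemma coefM_top (A B : {poly k}) m n : (size A <= m.+1)%N -> (size B <= n.+1)%N ->
  (A * B)`_(m + n) = A`_m * B`_n.
Proof.
move=> sA sB; have lt : (m < (m + n).+1)%N by lia.
rewrite coefM (bigD1 (Ordinal lt)) //= addKn big1 ?addr0 // => j jm.
have {}jm : (j : nat) != m by rewrite -val_eqE in jm.
case: (ltngtP j m) => h; last by rewrite h eqxx in jm.
  by rewrite [B`__]nth_default ?mulr0 // (leq_trans sB) //; lia.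
by rewrite nth_default ?mul0r // (leq_trans sA).
Qed.

Lemma gradedM e e' c c' h h' : graded e c h -> graded e' c' h' ->
  graded (e + e') (c * c') (fun T => h T * h' T).
Proof.
move=> [p [p1 p2 pe hp]] [q [q1 q2 qe hq]].
have sf := size_rhs_poly C.
(* Replacing y^2 by f - y creates degree at most (e - 3) + (e' - 3) + 5 = e + e' - 1, below the top
   coefficient. When e or e' is at most 2, truncated subtraction forces a zero y-part, hence the
   separate zero cases. *)
have s2 : (size (p.2 * q.2 * f)%R <= e + e')%N.
  have [->|p0] := eqVneq p.2 0; first by rewrite !mul0r size_poly0.
  have [->|q0] := eqVneq q.2 0; first by rewrite mulr0 mul0r size_poly0.
  have f0 : f != 0 by rewrite -size_poly_gt0 sf.
  rewrite size_mul ?mulf_neq0 // size_mul // sf.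
  move: p0 q0 p2 q2; rewrite -!size_poly_gt0.
  by set a := size p.2; set b := size q.2; lia.
have mle (A B : {poly k}) m n l : (size A <= m)%N -> (size B <= n - 2)%N ->
    (m + n <= l.+1)%N -> (size (A * B)%R <= l - 2)%N.
  have [->|B0] := eqVneq B 0; first by rewrite mulr0 size_poly0.
  move: B0; rewrite -size_poly_gt0 => B0 sA sB mn.
  apply: leq_trans (size_polyMleq _ _) _; move: B0 sA sB.
  by set a := size A; set b := size B; lia.
exists (qmul f p q); split=> [||| T aT] /=.
- rewrite (leq_trans (size_polyD _ _)) // geq_max (leq_trans s2) ?andbT //.
  apply: leq_trans (size_polyMleq _ _) _; move: p1 q1.
  by set a := size p.1; set b := size q.1; lia.
- rewrite (leq_trans (size_polyD _ _)) // geq_max size_polyN.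
  apply/andP; split; last first.
    by apply: (mle _ _ e.+1 e') => //; lia.
  rewrite (leq_trans (size_polyD _ _)) // geq_max; apply/andP; split.
    by apply: (mle _ _ e.+1 e') => //; lia.
  by rewrite mulrC; apply: (mle _ _ e'.+1 e) => //; lia.
- rewrite coefD [X in _ + X]nth_default // addr0 coefM_top // rmorphM.
  by rewrite pe qe.
- by rewrite qevalM // hp // hq.
Qed.

Lemma gradedX e c h n : graded e c h -> graded (e * n) (c ^+ n) (fun T => h T ^+ n).
Proof.
move=> hh; elim: n => [|n IH]; last first.
  rewrite mulnS; apply: eq_graded (gradedM hh IH) _ _; first by rewrite exprS.
  by move=> T _; rewrite exprS.
rewrite muln0; apply: eq_graded (gradedC 1) _ _; first by rewrite rmorph1.
by rewrite rmorph1.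
Qed.

Lemma graded_coord i : graded (wt i) (coords (Infinity iota C) i)
  (fun T => coords T i).
Proof.
move: i; apply: ord3_ind.
- exists ('X, 0); split=> [||| T aT] /=; rewrite ?size_polyX ?size_poly0 //.
    by rewrite coefX rmorph1.
  by rewrite coords_affine // qevalC ievalX.
- exists (0, 1); split=> [||| T aT] /=; rewrite ?size_poly1 ?size_poly0 //.
    by rewrite coef0 rmorph0.
  by rewrite coords_affine // /qeval ieval0 ieval1 add0r mul1r.
- exists (1, 0); split=> [||| T aT] /=; rewrite ?size_poly1 ?size_poly0 //.
    by rewrite coef1 rmorph0.
  by rewrite coords_affine // qevalC ieval1.
Qed.

Lemma graded_form (F : {mpoly k[3]}) e : F \is e.-homog for weight ->
  graded e (mmap iota (coords (Infinity iota C)) F)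
    (fun T => mmap iota (coords T) F).
Proof.
move=> /dhomogP hF; rewrite /mmap.
have monomial (m : 'X_{1..3}) : weight m = e ->
    graded e (iota F@_m * mmap1 (coords (Infinity iota C)) m)
      (fun T => iota F@_m * mmap1 (coords T) m).
  move=> <-; rewrite -[weight m]add0n; apply: gradedM; first exact: gradedC.
  rewrite /weight /mmap1.
  have gp (s : seq 'I_3) : graded (\sum_(i <- s) wt i * m i)%N
      (\prod_(i <- s) coords (Infinity iota C) i ^+ m i)
      (fun T => \prod_(i <- s) coords T i ^+ m i).
    elim: s => [|i s IH].
      rewrite !big_nil; apply: eq_graded (gradedC 1) (rmorph1 _) _ => T _.
      by rewrite rmorph1 big_nil.
    rewrite !big_cons.
      apply: eq_graded (gradedM (gradedX _ (graded_coord i)) IH) _ _ => //.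
    by move=> T _; rewrite big_cons.
  exact: gp.
(* Only the list summed over is generalized, not F, so that the induction still knows the weight of
   every monomial. *)
have: {subset msupp F <= msupp F} by [].
elim: {1 3 4}(msupp F) => [|m s IH] sF.
  rewrite big_nil; apply: eq_graded (graded0 e) _ _ => // T _.
  by rewrite big_nil.
rewrite big_cons; apply: eq_graded (gradedD (monomial m _) (IH _)) _ _ => //.
- by apply: hF; apply: sF; rewrite mem_head.
- by move=> m' ms; apply: sF; rewrite in_cons ms orbT.
- by move=> T _; rewrite big_cons.
Qed.

End WeightFiltration.

(** * Homogenizing functions along weighted forms *)

Section Homogenization.
Variables (k : fieldType) (K : closedFieldType) (iota : {rmorphism k -> K}).
Variable C : curve k.
Implicit Types (h X Y Z : point iota C -> K).

Lemma graded_sum n e (c : 'I_n -> K) (h : 'I_n -> point iota C -> K) :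
  (forall i, graded e (c i) (h i)) ->
  graded e (\sum_i c i) (fun T => \sum_i h i T).
Proof.
move=> gr.
suff gs (s : seq 'I_n) : graded e (\sum_(i <- s) c i) (fun T => \sum_(i <- s) h i T).
  exact: gs.
elim: s => [|i s IH].
  rewrite big_nil; apply: eq_graded (graded0 _ _ _) _ _ => // T _.
  by rewrite big_nil.
rewrite big_cons; apply: eq_graded (gradedD (gr i) IH) _ _ => // T _.
by rewrite big_cons.
Qed.

(** The witness is Z^d A(X/Z) expanded into monomials. It is defined also where Z vanishes, so the
    scale t may be 0. *)
Lemma homogenize (A : {poly k}) d e cX cZ X Z : (size A <= d.+1)%N ->
  graded e cX X -> graded e cZ Z ->
  exists c h, graded (e * d) c h /\
    forall T t x, X T = t * x -> Z T = t -> h T = t ^+ d * ieval iota A x.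
Proof.
move=> sA gX gZ.
exists (\sum_(i < d.+1) iota A`_i * (cX ^+ i * cZ ^+ (d - i))).
exists (fun T => \sum_(i < d.+1) iota A`_i * (X T ^+ i * Z T ^+ (d - i))); split.
  apply: graded_sum => i.
  have -> : (e * d = 0 + (e * i + e * (d - i)))%N.
    by rewrite -mulnDr add0n subnKC // -ltnS.
  by apply: gradedM; [exact: gradedC | apply: gradedM; exact: gradedX].
move=> T t x -> ->; rewrite /ieval (@horner_coef_wide _ d.+1) ?size_map_poly //.
rewrite big_distrr; apply: eq_bigr => i _ /=; rewrite coef_map /= exprMn.
have id : (i <= d)%N by rewrite -ltnS.
have -> : t ^+ d = t ^+ i * t ^+ (d - i) by rewrite -exprD subnKC.
by ring.
Qed.

Lemma qhomogenize (p : {poly k} * {poly k}) d e cX cY cZ X Y Z :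
  (size p.1 <= d.+1)%N -> (size p.2 <= d - 2)%N ->
  graded e cX X -> graded (e * 3) cY Y -> graded e cZ Z ->
  exists c h, graded (e * d) c h /\ forall T t x y,
    X T = t * x -> Y T = t ^+ 3 * y -> Z T = t ->
    h T = t ^+ d * (ieval iota p.1 x + ieval iota p.2 x * y).
Proof.
move=> p1 p2 gX gY gZ; have [c [h [gh hE]]] := homogenize p1 gX gZ.
(* For d at most 2 the bound d - 2 is 0 and there is no y-part. Otherwise the y-part is homogenized
   in degree d - 3, since y has weight 3. *)
have [d2|d3] := leqP d 2.
  exists c, h; split=> // T t x y XT YT ZT; rewrite (hE T t x) //.
  have /eqP -> : p.2 == 0 by rewrite -size_poly_leq0 (leq_trans p2) //; lia.
  by rewrite ieval0 mul0r addr0.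
have {}p2 : (size p.2 <= (d - 3).+1)%N by apply: leq_trans p2 _; lia.
have [c' [h' [gh' hE']]] := homogenize p2 gX gZ.
exists (c + cY * c'), (fun T => h T + Y T * h' T); split.
  apply: gradedD => //; have -> : (e * d = e * 3 + e * (d - 3))%N.
    by rewrite -mulnDr subnKC.
  exact: gradedM.
move=> T t x y XT YT ZT; rewrite (hE T t x) // (hE' T t x) // YT.
have -> : t ^+ d = t ^+ 3 * t ^+ (d - 3) by rewrite -exprD subnKC.
by ring.
Qed.

End Homogenization.

(** * Weighted forms representing a morphism *)

Section LocalForms.
Variables (k : fieldType) (K : closedFieldType) (iota : {rmorphism k -> K}).
Variables (C C' : curve k) (F : poly_map k) (phi : point iota C -> point iota C').
Hypothesis Fphi : given_by F phi.

(** Where all forms of F vanish the scale is t = 0. The relations between the forms and [phi] thus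
    hold at every T with affine image and can be used as identities of functions. *)
Lemma given_affine T : affine (phi T) -> exists t,
  [/\ peval iota F (coords T) ord0 = t * px (phi T),
      peval iota F (coords T) 1 = t ^+ 3 * py (phi T),
      peval iota F (coords T) ord_max = t,
      (exists i, peval iota F (coords T) i != 0) -> t != 0
    & forall i, peval iota F (coords T) i = t ^+ wt i * coords (phi T) i].
Proof.
move=> aT; have [nz|z] := pselect (exists i, peval iota F (coords T) i != 0).
  have [t t0 ht] := Fphi nz; exists t; split=> //; rewrite !ht coords_affine //.
  by rewrite /triple !(tnth_nth 0) /= ?expr1 ?mulr1.
have {}z i : peval iota F (coords T) i = 0.
  by apply/eqP/negbNE/negP => zi; apply: z; exists i.
exists 0; rewrite !z expr0n !mul0r; split=> // [[i]|i]; rewrite z ?eqxx //.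
by rewrite /wt; case: ifP; rewrite ?expr1 ?expr0n mul0r.
Qed.

Lemma given_infinity T : ~~ affine (phi T) ->
  (exists i, peval iota F (coords T) i != 0) ->
  exists2 t, t != 0 &
    forall i, peval iota F (coords T) i = t ^+ wt i * coords (Infinity iota C') i.
Proof.
by move=> /naffine e nz; have [t t0 ht] := Fphi nz; exists t => // i; rewrite ht e.
Qed.

End LocalForms.

(** The y-part contributes an odd degree of at most 2(e - 3) + 5 = 2e - 1, so a nonzero coefficient
    of x^e dominates it. *)
Lemma qdeg_graded (k : fieldType) (f : {poly k}) (p : {poly k} * {poly k}) e :
  size f = 6%N -> (size p.1 <= e.+1)%N -> (size p.2 <= e - 2)%N ->
  (qdeg f p <= 2 * e)%N /\ (p.1`_e != 0 -> qdeg f p = (2 * e)%N).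
Proof.
case: p => A B f6 /= sA sB; rewrite /qdeg size_qnorm //= -size_poly_eq0; split.
  by move: sA sB; set a := size A; set b := size B; case: eqP; lia.
move=> Ae; have : (e < size A)%N by rewrite ltnNge; apply: contraNN Ae => /leq_sizeP->.
by move: sA sB; set a := size A; set b := size B; case: eqP; lia.
Qed.

(** * Isomorphisms fix infinity *)

(** Here g has a pole of order at most 2d - 1 at infinity, one less than weight d allows. So x g^2
    has order at most 2 + 2(2d - 1) = 4d, the bound for weight 2d. *)
Lemma size_qmulX_sqr (k : fieldType) (f : {poly k}) (g : {poly k} * {poly k}) d :
  size f = 6%N -> (size g.1 <= d)%N -> (size g.2 <= d - 2)%N ->
  let p := qmul f ('X, 0) (qmul f g g) in
  (size p.1 <= (2 * d).+1)%N /\ (size p.2 <= 2 * d - 2)%N.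
Proof.
move=> f6 g1 g2 /=.
have sM (A B : {poly k}) m n l : (size A <= m)%N -> (size B <= n)%N ->
    (m + n <= l.+1)%N -> (size (A * B)%R <= l)%N.
  move=> sA sB mn; apply: leq_trans (size_polyMleq _ _) _; move: sA sB.
  by set a := size A; set b := size B; lia.
have [z|nz2] := eqVneq g.2 0.
  rewrite /qmul /= z !(mul0r, mulr0, addr0, subr0, size_poly0); split=> //.
  apply: (sM _ _ 2%N (2 * d)%N); rewrite ?size_polyX //.
  by apply: (sM _ _ d d) => //; lia.
have {}nz2 : (2 < d)%N.
  by move: nz2 g2; rewrite -size_poly_gt0; set b := size _; lia.
have s22f : (size (g.2 * g.2 * f)%R <= 2 * d)%N.
  apply: (sM _ _ (2 * (d - 2)).-1 6%N); rewrite ?f6 //; last by lia.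
  by apply: (sM _ _ (d - 2)%N (d - 2)%N) => //; lia.
have s12 : (size (g.1 * g.2)%R <= 2 * d - 3)%N by apply: (sM _ _ d (d - 2)%N) => //; lia.
have s2 : (size (g.2 * g.2)%R <= 2 * d - 3)%N.
  by apply: (sM _ _ (d - 2)%N (d - 2)%N) => //; lia.
rewrite /qmul /= !(mul0r, addr0, subr0); split.
  apply: (sM _ _ 2%N (2 * d)%N); rewrite ?size_polyX //.
  rewrite (leq_trans (size_polyD _ _)) // geq_max s22f andbT.
  by apply: (sM _ _ d d) => //; lia.
apply: (sM _ _ 2%N (2 * d - 3)%N); rewrite ?size_polyX //; last by lia.
rewrite (leq_trans (size_polyD _ _)) // geq_max size_polyN s2 andbT.
by rewrite (leq_trans (size_polyD _ _)) // geq_max s12 mulrC s12.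
Qed.

Section PointAtInfinity.
Variables (k : fieldType) (ch2 : 2%N \in [pchar k]).
Variables (K : closedFieldType) (iota : {rmorphism k -> K}).

(* The function phi^*x - x0 vanishes at infinity, so that its square cancels the
   double pole of x. *)
Lemma pole_cancel (C C' : curve k) (phi : point iota C -> point iota C') d F :
  wformed d F -> given_by F phi ->
  (exists i, peval iota F (coords (Infinity iota C)) i != 0) ->
  affine (phi (Infinity iota C)) ->
  exists (x0 : k) (p : {poly k} * {poly k}),
  [/\ iota x0 = px (phi (Infinity iota C)),
      (size p.1 <= (2 * d).+1)%N /\ (size p.2 <= 2 * d - 2)%N,
      peval iota F (coords (Infinity iota C)) ord_max != 0
    & forall U, affine U -> affine (phi U) -> qeval p U =
        px U * (peval iota F (coords U) ord_max * (px (phi U) - iota x0)) ^+ 2].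
Proof.
move=> hF gF nz aI; have [t [F0 _ F2 /(_ nz) t0 _]] := given_affine gF aI.
have hF0 : F ord0 \is d.-homog for weight by rewrite -[d]muln1; exact: hF ord0.
have hF2 : F ord_max \is d.-homog for weight.
  by rewrite -[d]muln1; exact: hF ord_max.
have [p0 [s01 s02 c0 e0]] := graded_form iota C hF0.
have [p2 [s21 s22 c2 e2]] := graded_form iota C hF2.
(* The values of the forms at infinity are top coefficients in k, so the image of infinity has its
   abscissa in k. Subtracting x0 times the last form then cancels the coefficient of degree d. *)
pose x0 := p0.1`_d / p2.1`_d.
have ix0 : iota x0 = px (phi (Infinity iota C)).
  by rewrite fmorph_div c0 c2 [X in X / _]F0 [X in _ / X]F2 mulrC mulKf.
pose g : {poly k} * {poly k} := (p0.1 - x0 *: p2.1, p0.2 - x0 *: p2.2).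
have g1 : (size g.1 <= d)%N.
  apply/leq_sizeP => j dj; rewrite coefB coefZ; have [->|jd] := eqVneq j d.
    rewrite divfK ?subrr // -(fmorph_eq0 iota) c2.
    by rewrite [X in X != 0]F2.
  by rewrite !nth_default ?mulr0 ?subr0 // (leq_trans _ (_ : d.+1 <= j)%N) //; lia.
have g2 : (size g.2 <= d - 2)%N.
  rewrite (leq_trans (size_polyD _ _)) // geq_max s02 size_polyN.
  by rewrite (leq_trans (size_scale_leq _ _)).
exists x0, (qmul (rhs_poly C) ('X, 0) (qmul (rhs_poly C) g g)); split=> //.
- by apply: size_qmulX_sqr; first exact: size_rhs_poly.
- by rewrite F2.
move=> U aU aphiU.
have [t' [F0' _ F2' _ _]] := given_affine gF aphiU.
rewrite !qevalM // qevalC ievalX -expr2; congr (_ * _ ^+ 2).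
have -> : qeval g U = qeval p0 U - iota x0 * qeval p2 U.
  by rewrite /qeval /g /= !ievalE; ring.
rewrite -e0 // -e2 // [X in X - _]F0' [X in _ - _ * X]F2' F2'.
by ring.
Qed.

(** Near Q the map is (p0/p2, p1/p2^3). When Q is infinity, nonvanishing of p2 becomes degree
    exactly 2e, and the bound on p0 says that the abscissa of [phi] has no pole there. *)
Lemma local_fraction (C C' : curve k) (phi : point iota C -> point iota C') Q :
  is_morphism phi -> affine (phi Q) ->
  exists e (p0 p1 p2 : {poly k} * {poly k}),
  [/\ forall T, affine T -> affine (phi T) ->
        qeval p2 T * px (phi T) = qeval p0 T /\
        qeval p2 T ^+ 3 * py (phi T) = qeval p1 T,
      p2 != 0 /\ (affine Q -> qeval p2 Q != 0), (qdeg (rhs_poly C) p0 <= 2 * e)%N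
    & ~~ affine Q -> qdeg (rhs_poly C) p2 = (2 * e)%N].
Proof.
move=> /(_ Q)[e [F [hF nF gF]]] aQ.
have hF0 : F ord0 \is e.-homog for weight by rewrite -[e]muln1; exact: hF ord0.
have hF2 : F ord_max \is e.-homog for weight.
  by rewrite -[e]muln1; exact: hF ord_max.
have [p0 [s01 s02 _ e0]] := graded_form iota C hF0.
have [p1 [_ _ _ e1]] := graded_form iota C (hF 1).
have [p2 [s21 s22 c2 e2]] := graded_form iota C hF2.
have [t [_ _ tQ /(_ nF) t0 _]] := given_affine gF aQ.
have aff_neq0 : affine Q -> qeval p2 Q != 0.
  by move=> aQ'; rewrite -e2 // [X in X != _]tQ.
have inf_neq0 : ~~ affine Q -> p2.1`_e != 0.
  by move=> /naffine Q0; rewrite -(fmorph_eq0 iota) c2 -Q0 [X in X != _]tQ.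
exists e, p0, p1, p2; split=> [T aT aphiT|||nQ].
- have [t' [F0 F1 F2 _ _]] := given_affine gF aphiT.
  rewrite -e0 // -e1 // -e2 // [X in X * _]F2 [X in X ^+ _]F2.
  by rewrite [mmap _ _ _]F0 [mmap _ _ _]F1.
- split=> //; have [aQ'|nQ] := boolP (affine Q).
    by apply: contraNneq (aff_neq0 aQ') => ->; rewrite /qeval !ieval0 mul0r addr0.
  by apply: contraNneq (inf_neq0 nQ) => ->; rewrite coef0.
- by case: (qdeg_graded (size_rhs_poly C) s01 s02).
- exact: (qdeg_graded (size_rhs_poly C) s21 s22).2 (inf_neq0 nQ).
Qed.

Variables (C C' : curve k) (phi : isom iota C C').
Local Notation psi := (bwd phi).
Local Notation infty := (Infinity iota C).
Hypothesis aI : affine (fwd phi infty).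

Lemma affine_bwd T : px T != px (fwd phi infty) -> affine (psi T).
Proof.
apply: contraNT => /naffine e; have := bwdK phi T; rewrite e => ->.
by rewrite eqxx.
Qed.

Lemma affine_bwd_infty : affine (psi (Infinity iota C')).
Proof.
apply: contraLR aI => /naffine e; have := bwdK phi (Infinity iota C').
by rewrite e => ->.
Qed.

(** The abscissa of [psi] has its only affine pole, a double one, at the image of infinity, and no
    pole at infinity since [psi] is affine there. The square of x - x0 clears the affine pole and
    has degree 4, too small for a y-part. *)
Lemma double_pole : exists (x0 : k) (A : {poly k}),
  [/\ iota x0 = px (fwd phi infty), (size A <= 3)%N
    & forall T, affine T -> px T != iota x0 ->
        (px T - iota x0) ^+ 2 * px (psi T) = ieval iota A (px T)].
Proof.
have [d [F [hF nF gF]]] := fwd_morph phi infty.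
have [x0 [N [ix0 [N1 N2] F2 NE]]] := pole_cancel hF gF nF aI.
pose S : {poly k} := 'X - x0%:P.
have S0 : S != 0 by rewrite polyXsubC_eq0.
have SE (T : point iota C') : ieval iota S (px T) = px T - iota x0 by rewrite !ievalE.
pose r T := (px T - iota x0) ^+ 2 * px (psi T).
have sqE (T : point iota C') : qeval (S ^+ 2, 0) T = (px T - iota x0) ^+ 2.
  by rewrite qevalC ievalXn SE.
have good T : ieval iota S (px T) != 0 -> affine (psi T).
  by rewrite SE subr_eq0 ix0; exact: affine_bwd.
have [|w hw] := @regular_everywhere k K iota ch2 C' S r S0 _.
  move=> Q aQ; have [aR|nR] := boolP (affine (psi Q)).
    have [e [p0 [p1 [p2 [h [_ /(_ aQ) n2] _ _]]]]] := local_fraction (bwd_morph phi) aR.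
    exists p2, (qmul (rhs_poly C') (S ^+ 2, 0) p0); split=> // T aT sT.
    have [h2 _] := h T aT (good T sT).
    by rewrite qevalM // sqE -h2 /r; ring.
  (* At a point sent to infinity the denominator is the square of the last form of F composed with
     G. The numerator is the function of [pole_cancel], homogenized along G and read at [psi T]. *)
  have [e [G [hG nG gG]]] := bwd_morph phi Q.
  have hG0 : G ord0 \is e.-homog for weight by rewrite -[e]muln1; exact: hG ord0.
  have hG2 : G ord_max \is e.-homog for weight.
    by rewrite -[e]muln1; exact: hG ord_max.
  have [c [h [[p [_ _ _ hp]] hE]]] := qhomogenize N1 N2
    (graded_form iota C' hG0) (graded_form iota C' (hG 1)) (graded_form iota C' hG2).
  have hH : poly_comp F G ord_max \is (e * d)%N.-homog for weight.
    by rewrite -[(e * d)%N]muln1; exact: (wformed_comp hG hF ord_max).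
  have [q [_ _ _ hq]] := graded_form iota C' hH.
  have HE (T : point iota C') u (U : point iota C) :
      (forall i, peval iota G (coords T) i = u ^+ wt i * coords U i) ->
      mmap iota (coords T) (poly_comp F G ord_max)
      = u ^+ d * peval iota F (coords U) ord_max.
    move=> hu; have := peval_comp iota F G (coords T) ord_max.
    rewrite {1}/peval => ->; rewrite /peval (mmap_scale iota (hF ord_max) hu).
    by rewrite [wt _]/= muln1.
  exists (qmul (rhs_poly C') q q), p; split.
    rewrite qevalM // -hq // -expr2 expf_neq0 //.
    have [t t0 ht] := given_infinity gG nR nG.
    by rewrite (HE _ _ _ ht) mulf_neq0 // expf_neq0.
  move=> T aT sT; rewrite qevalM // -hq // -hp //.
  have apT := good T sT.
  have [t [t0 t1 t2 _ ht]] := given_affine gG apT.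
  rewrite (hE T t (px (psi T)) (py (psi T))) // (HE T t (psi T)) //.
  rewrite [X in _ = _ * X](NE (psi T)) ?bwdK //.
  by rewrite /r mulnC exprM; ring.
(* Near infinity the abscissa of [psi] is p0/p2 with deg p0 at most deg p2. Hence p2 w = S^2 p0
   bounds deg w by deg S^2 = 4. *)
have [w3 w2] : (size w.1 <= 3)%N /\ w.2 = 0.
  apply: (@qdeg_lt5 _ (rhs_poly C') (size_rhs_poly C')).
  have [e [p0 [p1 [p2 [h [p20 _] d0 d2]]]]] :=
    local_fraction (bwd_morph phi) affine_bwd_infty.
  have [->|w0] := eqVneq w 0; first by rewrite (qdegC (size_rhs_poly C') 0).
  have eqw : qmul (rhs_poly C') p2 w = qmul (rhs_poly C') (S ^+ 2, 0) p0.
    apply/eqP; rewrite -subr_eq0; apply/eqP.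
    apply: (@qeval_inj _ _ iota C' _ S) => // T aT sT.
    rewrite qevalD qevalN !qevalM // sqE -hw // /r.
    by have [<- _] := h T aT (good T sT); ring.
  have := congr1 (qdeg (rhs_poly C')) eqw.
  rewrite (qdegM (size_rhs_poly C') p20 w0) (d2 isT).
  have p00 : p0 != 0.
    apply: contraTneq (qmul_neq0 (size_rhs_poly C') p20 w0) => p00.
    by rewrite eqw p00 /qmul /= !(mulr0, mul0r, addr0, subr0) eqxx.
  have Sq : qdeg (rhs_poly C') (S ^+ 2, 0) = 4%N.
    by rewrite /qdeg qnormC -exprM size_exp_XsubC.
  rewrite (qdegM (size_rhs_poly C')) ?Sq // => [|]; first by move: d0; lia.
  by apply: contra_eqT Sq => /negPn/eqP ->; rewrite (qdegC (size_rhs_poly C') 0).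
exists x0, w.1; split=> // T aT nT.
have sT : ieval iota S (px T) != 0 by rewrite SE subr_eq0.
by rewrite -/(r T) hw // /qeval w2 ieval0 mul0r addr0.
Qed.

Lemma affine_infinity_absurd : False.
Proof.
have ch2K : 2%N \in [pchar K] := rmorph_pchar iota ch2.
have [x0 [A [ix0 sA hA]]] := double_pole.
pose S : {poly k} := 'X - x0%:P.
have S0 : S != 0 by rewrite polyXsubC_eq0.
have SE (x : K) : ieval iota S x = x - iota x0 by rewrite !ievalE.
(* Away from x0 the abscissa of [psi] equals both A/S^2 and p0/p2. Cross-multiplying gives an
   identity of functions, hence of both components. *)
have local Q : affine Q -> affine (psi Q) -> exists (p0 p2 : {poly k} * {poly k}),
    [/\ qeval p2 Q != 0, qeval p2 Q * px (psi Q) = qeval p0 Q,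
        A * p2.1 = S ^+ 2 * p0.1 & A * p2.2 = S ^+ 2 * p0.2].
  move=> aQ aR; have [e [p0 [p1 [p2 [h [_ /(_ aQ) n2] _ _]]]]] :=
    local_fraction (bwd_morph phi) aR.
  have [e1 e2] : (A * p2.1, A * p2.2) = (S ^+ 2 * p0.1, S ^+ 2 * p0.2).
    apply/eqP; rewrite -subr_eq0; apply/eqP.
    apply: (@qeval_inj _ _ iota C' _ S) => // T aT; rewrite SE subr_eq0 => nT.
    have [|hT _] := h T aT _; first by apply: affine_bwd; rewrite -ix0.
    rewrite qevalD qevalN [X in _ - X](_ : _ = ieval iota (S ^+ 2) (px T) * qeval p0 T).
      by rewrite -hT ievalXn SE /qeval /= !ievalM -hA //; ring.
    by rewrite /qeval /= !ievalM; ring.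
  by exists p0, p2; split=> //; case: (h Q aQ aR).
have [c cA] : exists c, A = c%:P * S ^+ 2.
  (* The conjugate of [fwd phi infty] has the same abscissa x0 but another ordinate, so [psi] is
     affine there and has a local denominator p2 nonzero at that point. *)
  have aP1 : affine (hyp_fun ch2 (fwd phi infty)) by rewrite affine_hyp.
  have [|p0 [p2 [n2 _ e1 e2]]] := local _ aP1.
    apply: contraT => /naffine e; have := bwdK phi (hyp_fun ch2 (fwd phi infty)).
    rewrite e; case: (fwd phi infty) aI => //= x y h _ [] /eqP.
    by rewrite -subr_eq0 opprD addrA subrr sub0r oppr_eq0 oner_eq0.
  (* Evaluation at the conjugate point makes x0 a root of B while a factor S remains on the right.
     Used twice, this extracts S^2 from A. *)
  have root_of (B : {poly k}) n : B * p2.1 = S ^+ n.+1 * p0.1 ->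
      B * p2.2 = S ^+ n.+1 * p0.2 -> exists B', B = B' * S.
    move=> f1 f2; apply/factor_theorem; rewrite /root -(fmorph_eq0 iota).
    rewrite -horner_map /= -/(ieval iota B (iota x0)); apply/eqP.
    apply: (mulIf n2); rewrite mul0r /qeval px_hyp -ix0 mulrDr !mulrA.
    by rewrite -!ievalM f1 f2 !ievalM exprS !ievalM SE subrr !mul0r addr0.
  have [A1 A1S] := root_of A 1%N e1 e2.
  have cancelS (B D E : {poly k}) n : B * S * D = S ^+ n.+1 * E -> B * D = S ^+ n * E.
    by move=> h; apply: (mulfI S0); rewrite mulrA [S * B]mulrC h exprS mulrA.
  have [A2 A2S] : exists A2, A1 = A2 * S.
    by apply: (root_of A1 0%N); apply: cancelS; rewrite -A1S.
  exists A2`_0; rewrite -size1_polyC; first by rewrite A1S A2S -mulrA.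
  have [->|A20] := eqVneq A2 0; first by rewrite size_poly0.
  move: sA; rewrite A1S A2S !size_mul ?mulf_neq0 // size_XsubC.
  by set a := size A2; lia.
have const Q : affine Q -> affine (psi Q) -> px (psi Q) = iota c.
  move=> aQ aR; have [p0 [p2 [n2 h2 e1 e2]]] := local Q aQ aR.
  have {}e1 : c%:P * p2.1 = p0.1.
    by apply: (mulfI (expf_neq0 2 S0)); rewrite -e1 cA; ring.
  have {}e2 : c%:P * p2.2 = p0.2.
    by apply: (mulfI (expf_neq0 2 S0)); rewrite -e2 cA; ring.
  apply: (mulfI n2); rewrite h2 /qeval -e1 -e2 !ievalM ievalC.
  by ring.
(* Avoiding the abscissa of [psi] at infinity makes [fwd phi U] affine; avoiding c contradicts the
   constancy of the abscissa of [psi]. *)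
have [x] : exists x, ~~ root (('X - (iota c)%:P)
    * ('X - (px (psi (Infinity iota C')))%:P)) x.
  by apply/closed_nonrootP; rewrite mulf_neq0 // polyXsubC_eq0.
rewrite rootM !root_XsubC => /norP[xc xI].
have [U aU Ux] := point_above iota C x.
have aV : affine (fwd phi U).
  apply: contraNT xI => /naffine <-; by rewrite fwdK Ux.
by have := const _ aV; rewrite fwdK Ux => /(_ aU) /eqP; rewrite (negbTE xc).
Qed.

End PointAtInfinity.

Lemma fwd_infty (k : fieldType) (ch2 : 2%N \in [pchar k]) (K : closedFieldType)
    (iota : {rmorphism k -> K}) (C C' : curve k) (phi : isom iota C C') :
  fwd phi (Infinity iota C) = Infinity iota C'.
Proof.
case e : (fwd phi _) => [x y h|] //; exfalso.
by apply: (affine_infinity_absurd ch2 (phi := phi)); rewrite e.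
Qed.

Lemma affine_fwd (k : fieldType) (ch2 : 2%N \in [pchar k]) (K : closedFieldType)
    (iota : {rmorphism k -> K}) (C C' : curve k) (phi : isom iota C C') T :
  affine T -> affine (fwd phi T).
Proof.
apply: contraTT => /naffine e; have := fwdK phi T.
by rewrite e [bwd _ _](fwd_infty ch2 (isom_inv phi)) => <-.
Qed.

(** * The form of an isomorphism *)

Section IsomorphismForm.
Variables (k : fieldType) (ch2 : 2%N \in [pchar k]).
Variables (K : closedFieldType) (iota : {rmorphism k -> K}).

(** Affine points have affine images, so [local_fraction] gives a denominator at every affine point.
    For the ordinate it is a cube, y having weight 3. *)
Lemma coordinates_regular (C C' : curve k) (phi : isom iota C C') :
  exists u w, forall T, affine T ->
    px (fwd phi T) = qeval u T /\ py (fwd phi T) = qeval w T.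
Proof.
have n0 (T : point iota C) : ieval iota 1 (px T) != 0 by rewrite ieval1 oner_neq0.
have [|u hu] := @regular_everywhere k K iota ch2 C 1
    (fun T => px (fwd phi T)) (oner_neq0 _).
  move=> Q aQ; have [e [p0 [p1 [p2 [h [_ /(_ aQ) n2] _ _]]]]] :=
    local_fraction (fwd_morph phi) (affine_fwd ch2 phi aQ).
  exists p2, p0; split=> // T aT _.
  by case: (h T aT (affine_fwd ch2 phi aT)).
have [|w hw] := @regular_everywhere k K iota ch2 C 1
    (fun T => py (fwd phi T)) (oner_neq0 _).
  move=> Q aQ; have [e [p0 [p1 [p2 [h [_ /(_ aQ) n2] _ _]]]]] :=
    local_fraction (fwd_morph phi) (affine_fwd ch2 phi aQ).
  exists (qmul (rhs_poly C) p2 (qmul (rhs_poly C) p2 p2)), p1; split=> [|T aT _].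
    by rewrite !qevalM // !mulf_neq0.
  have [_ <-] := h T aT (affine_fwd ch2 phi aT).
  by rewrite !qevalM //=; ring.
by exists u, w => T aT; split; [exact: hu | exact: hw].
Qed.

Lemma qdeg_addC (C : curve k) p c : (0 < qdeg (rhs_poly C) p)%N ->
  qdeg (rhs_poly C) (p + (c%:P, 0)) = qdeg (rhs_poly C) p.
Proof.
move=> d0; rewrite addrC qdegDr ?(qdegC (size_rhs_poly C)) //.
exact: size_rhs_poly.
Qed.

(** Horner's scheme: each multiplication by u adds its degree, and added constants do not change a
    positive degree. The last clause is carried along because degree 0 does not separate 0 from
    nonzero constants. *)
Lemma qeval_comp (C : curve k) u (A : {poly k}) : (0 < qdeg (rhs_poly C) u)%N ->
  exists q, [/\ forall T : point iota C, affine T -> ieval iota A (qeval u T) = qeval q T,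
    qdeg (rhs_poly C) q = ((size A).-1 * qdeg (rhs_poly C) u)%N
    & A != 0 -> q != 0].
Proof.
move=> u0; have f6 := size_rhs_poly C.
elim/poly_ind: A => [|A c [q [hq dq nq]]].
  exists 0; split=> [T aT||]; rewrite ?eqxx ?ieval0 //.
    by rewrite /qeval !ieval0 mul0r addr0.
  by rewrite size_poly0 mul0n (qdegC f6 0).
exists (qmul (rhs_poly C) q u + (c%:P, 0)).
have ev (T : point iota C) : affine T -> ieval iota (A * 'X + c%:P) (qeval u T)
    = qeval (qmul (rhs_poly C) q u + (c%:P, 0)) T.
  by move=> aT; rewrite qevalD qevalM // -hq // qevalC !ievalE.
have [A0|A0] := eqVneq A 0.
  have q0 : q = 0.
    apply: (@qeval_inj_affine _ _ iota C) => T aT; rewrite -hq // A0 ieval0.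
    by rewrite /qeval !ieval0 mul0r addr0.
  split=> //; rewrite A0 q0 /qmul /= !(mul0r, mulr0, addr0, subr0, add0r).
    rewrite (qdegC f6) size_polyC; case: (c != 0) => //.
  by rewrite xpair_eqE eqxx andbT.
have u1 := qdeg_neq0 f6 u0.
have d0 : (0 < qdeg (rhs_poly C) (qmul (rhs_poly C) q u))%N.
  by rewrite (qdegM f6 (nq A0) u1); lia.
split=> //; last first.
  by move=> _; apply: (@qdeg_neq0 _ (rhs_poly C)) => //; rewrite qdeg_addC.
rewrite qdeg_addC // (qdegM f6 (nq A0) u1) dq size_MXaddC (negbTE A0) /=.
by move: A0; rewrite -size_poly_gt0; case: (size A) => //= n _; rewrite mulSn addnC.
Qed.

Variables (C C' : curve k) (phi : isom iota C C').
Local Notation f := (rhs_poly C).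

Lemma isom_form :
  exists (l n : k) (v : {poly k}),
  [/\ l != 0, (size v <= 3)%N,
      rhs_poly C' \Po (l *: 'X + n%:P) = v ^+ 2 + v + rhs_poly C
    & forall T, affine T -> px (fwd phi T) = iota l * px T + iota n /\
        py (fwd phi T) = py T + ieval iota v (px T)].
Proof.
have [u [w huw]] := coordinates_regular phi.
have f6 := size_rhs_poly C.
have afwd T : affine T -> affine (fwd phi T) := @affine_fwd _ ch2 _ _ _ _ phi T.
(* A constant abscissa c would leave the points above c + 1 without preimage. *)
have u0 : (0 < qdeg f u)%N.
  rewrite lt0n; apply/eqP => /(qdeg_eq0 f6)[c uc].
  have [T' aT' T'c] := point_above iota C' (iota c + 1).
  have aT := @affine_fwd _ ch2 _ _ _ _ (isom_inv phi) _ aT'.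
  have [] := huw _ aT; rewrite bwdK uc qevalC ievalC T'c => /eqP.
  by rewrite -subr_eq0 addrC addKr oner_eq0.
have [qf [hqf dqf nqf]] := qeval_comp (rhs_poly C') u0.
rewrite size_rhs_poly /= in dqf.
have rel : qmul f w (w + (1%:P, 0)) = qf.
  apply: (@qeval_inj_affine _ _ iota C) => T aT.
  rewrite qevalM // qevalD qevalC ievalC rmorph1 -hqf //.
  have [<- <-] := huw T aT; have := py_eqn (afwd T aT).
  by rewrite mulrDr mulr1 -expr2 => ->; rewrite subrK.
have dw : (2 * qdeg f w = 5 * qdeg f u)%N.
  (* A constant w would make w^2 + w = f'(u) constant, although its degree is five times that of
     u. *)
  have [z|w0] := posnP (qdeg f w).
    have [c wc] := qdeg_eq0 f6 z.
    move: dqf; rewrite -rel wc /qmul /= !(mul0r, mulr0, addr0, subr0) -polyCD -polyCM.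
    by rewrite (qdegC f6); move: u0; set d := qdeg f u; lia.
  have w1 : (0 < qdeg f (w + (1%:P, 0))%R)%N by rewrite (qdeg_addC _ w0).
  rewrite -dqf -rel (qdegM f6 (qdeg_neq0 f6 w0) (qdeg_neq0 f6 w1)) (qdeg_addC _ w0).
  by lia.
(* The inverse gives x = A(u) + B(u) w. With deg u = 2m and deg w = 5m the terms have degrees 2ma
   and 2mb + 5m, which never agree, so the larger is deg x = 2. Only 2ma = 2 is possible, whence m =
   1. *)
have du : qdeg f u = 2%N.
  have [[A B] [w' huw']] := coordinates_regular (isom_inv phi).
  have [qA [hA dA nA]] := qeval_comp A u0.
  have [qB [hB dB nB]] := qeval_comp B u0.
  have e : ('X, 0) = qA + qmul f qB w.
    apply: (@qeval_inj_affine _ _ iota C) => T aT; rewrite qevalC ievalX.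
    have [] := huw' _ (afwd T aT); rewrite /= fwdK => -> _.
    rewrite qevalD qevalM // -hA // -hB //; have [<- <-] := huw T aT.
    by [].
  have dX : qdeg f ('X, 0) = 2%N by rewrite /qdeg qnormC size_polyXn.
  have f1 p q := @qdegM _ f f6 p q.
  have f2 p q := @qdegDr _ f f6 p q.
  have w0 : (0 < qdeg f w)%N by move: dw u0; lia.
  have nw := qdeg_neq0 f6 w0.
  have [B0|B0] := eqVneq B 0.
    have qB0 : qB = 0.
      apply: (@qeval_inj_affine _ _ iota C) => T aT; rewrite -hB // B0 ieval0.
      by rewrite /qeval !ieval0 mul0r addr0.
    move: e; rewrite qB0 /qmul /= !(mul0r, addr0, subr0) => e.
    move: dA; rewrite -e dX; move: dw u0; set a := (size A).-1.
    by set m := qdeg f u; set n := qdeg f w; nia.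
  move: (f1 _ _ (nB B0) nw); rewrite dB => dqB.
  move: dX; rewrite e.
  case: (ltngtP (qdeg f qA) (qdeg f (qmul f qB w))) => cmp.
  - rewrite f2 // dqB => d2; exfalso; move: d2 dw u0.
    by set b := (_.-1 * _)%N; lia.
  - rewrite addrC f2 // dA; move: dw u0; set a := (size A).-1.
    by set m := qdeg f u; set n := qdeg f w; nia.
  - exfalso; have /eqP : (qdeg f u * (2 * (size A).-1) =
        qdeg f u * (2 * (size B).-1 + 5))%N.
      by move: cmp dw; rewrite dA dqB; nia.
    by rewrite eqn_pmul2l //; set a := (size A).-1; set b := (size B).-1; lia.
have [su uE] := qdeg2 f6 du.
have [sw sm] : (size w.1 <= 3)%N /\ size w.2 = 1%N.
  by apply: (qdeg5 f6); move: dw; rewrite du; lia.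
case: u huw hqf su uE {u0 dqf dw du} => U U2 huw hqf /= sU U20.
rewrite {U2}U20 in huw hqf.
have Uaff : U = U`_1 *: 'X + (U`_0)%:P.
  apply/polyP => i; rewrite coefD coefZ coefX coefC.
  case: i => [|[|i]]; rewrite /= ?mulr0 ?mulr1 ?add0r ?addr0 //.
  by rewrite nth_default // sU.
have qfE : qf = (rhs_poly C' \Po U, 0).
  apply: (@qeval_inj_affine _ _ iota C) => T aT.
  by rewrite -hqf // !qevalC /ieval map_comp_poly horner_comp.
case: w huw rel sw sm => V W huw rel /= sV /eqP/size_poly1P[m m0 Wm].
rewrite {W}Wm in huw rel.
have ch2P : 2%N \in [pchar {poly k}] by rewrite pchar_poly.
move: rel; rewrite qfE /qmul /= => -[rel1 rel2].
(* The y-part of w^2 + w is 2Vm + m - m^2, which must vanish because f'(u) has no y-part. *)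
have m1 : m = 1.
  apply: (mulfI m0); rewrite mulr1; apply/polyC_inj; rewrite polyCM.
  apply/eqP; rewrite eq_sym -subr_eq0; apply/eqP; rewrite -[RHS]rel2 addr0.
  rewrite [RHS](_ : _ = V * m%:P + V * m%:P + (m%:P - m%:P * m%:P)); last by ring.
  by rewrite (addrr_pchar2 ch2P) add0r.
rewrite {m}m1 in m0 huw rel1 rel2.
exists U`_1, U`_0, V; split=> //.
- have : lead_coef U != 0 by rewrite lead_coef_eq0 -size_poly_gt0 sU.
  by rewrite lead_coefE sU.
- by rewrite -Uaff -rel1; ring.
- move=> T aT; have [-> ->] := huw T aT; split.
    by rewrite qevalC {1}Uaff !ievalE.
  by rewrite /qeval /= ievalC rmorph1 mul1r addrC.
Qed.
End IsomorphismForm.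

(** * Affine substitutions and their action on the coefficients *)

Section AffineIsomorphisms.
Variables (k : fieldType) (ch2 : 2%N \in [pchar k]).
Variables (K : closedFieldType) (iota : {rmorphism k -> K}).

Definition sextuple (c5 c4 c3 c2 c1 c0 : k) : {poly k} :=
  c5 *: 'X^5 + c4 *: 'X^4 + c3 *: 'X^3 + c2 *: 'X^2 + c1 *: 'X + c0%:P.

Lemma sextuple_inj c5 c4 c3 c2 c1 c0 c5' c4' c3' c2' c1' c0' :
  sextuple c5 c4 c3 c2 c1 c0 = sextuple c5' c4' c3' c2' c1' c0' ->
  [/\ c5 = c5', c4 = c4', c3 = c3' & [/\ c2 = c2', c1 = c1' & c0 = c0']].
Proof.
move=> e; have h i := congr1 (fun p : {poly k} => p`_i) e.
move: (h 5%N) (h 4%N) (h 3%N) (h 2%N) (h 1%N) (h 0%N).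
rewrite /sextuple !(coefD, coefZ, coefXn, coefX, coefC) /=.
by rewrite !(mulr0, mulr1, addr0, add0r).
Qed.

Lemma rhs_comp_affine (C : curve k) l n (a := val (cv_a C)) (b := cv_b C)
    (c := cv_c C) :
  rhs_poly C \Po (l *: 'X + n%:P) =
  sextuple (l ^+ 5 * a) (l ^+ 4 * (a * n + b)) (l ^+ 3 * c) (c * l ^+ 2 * n)
    (a * l * n ^+ 4 + c * l * n ^+ 2)
    (a * n ^+ 5 + b * n ^+ 4 + c * n ^+ 3 + cv_d C).
Proof.
have ch2P : 2%N \in [pchar {poly k}] by rewrite pchar_poly.
have two : 2%:R = 0 :> {poly k} by exact: pcharf0 ch2P.
rewrite /rhs_poly !rmorphD /= !linearZ /= !rmorphXn /= comp_polyX comp_polyC.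
rewrite /sextuple -/a -/b -/c -!mul_polyC !(polyCD, polyCM, polyC_exp).
move: (a%:P) (b%:P) (c%:P) (l%:P) (n%:P) ((cv_d C)%:P) => A B D L N M.
pose Y := L * 'X.
(* This is half the difference between the integral binomial expansion and the right-hand side: the
   ring identity holds after adding 2q = 0. *)
pose q := A * (2%:R * Y ^+ 4 * N + 5%:R * Y ^+ 3 * N ^+ 2 + 5%:R * Y ^+ 2 * N ^+ 3
    + 2%:R * Y * N ^+ 4)
  + B * (2%:R * Y ^+ 3 * N + 3%:R * Y ^+ 2 * N ^+ 2 + 2%:R * Y * N ^+ 3)
  + D * (Y ^+ 2 * N + Y * N ^+ 2).
by rewrite -[RHS]addr0 -(mul0r q) -two /q /Y; ring.
Qed.

Lemma quadratic_AS (C : curve k) (v : {poly k}) : (size v <= 3)%N ->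
  v ^+ 2 + v + rhs_poly C =
  sextuple (val (cv_a C)) (cv_b C + v`_2 ^+ 2) (cv_c C) (v`_1 ^+ 2 + v`_2) v`_1
    (v`_0 + v`_0 ^+ 2 + cv_d C).
Proof.
have ch2P : 2%N \in [pchar {poly k}] by rewrite pchar_poly.
have two : 2%:R = 0 :> {poly k} by exact: pcharf0 ch2P.
move=> sv; have -> : v = v`_2 *: 'X^2 + v`_1 *: 'X + (v`_0)%:P.
  apply/polyP => i; rewrite !(coefD, coefZ, coefXn, coefX, coefC).
  case: i => [|[|[|i]]]; rewrite /= ?mulr0 ?mulr1 ?add0r ?addr0 //.
  by rewrite nth_default // (leq_trans sv).
rewrite !(coefD, coefZ, coefXn, coefX, coefC) /= !(mulr0, mulr1, addr0, add0r).
rewrite /sextuple /rhs_poly -!mul_polyC !(polyCD, polyCM, polyC_exp).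
move: (v`_2)%:P (v`_1)%:P (v`_0)%:P => r s t.
(* Half of the cross terms in the square of v. *)
pose q : {poly k} := r * s * 'X ^+ 3 + r * t * 'X ^+ 2 + s * t * 'X.
by rewrite -[RHS]addr0 -(mul0r q) -two /q; ring.
Qed.

(** The coefficients of x and x^2 force v_1 = s and v_2 = r. The square r^2 then enters the
    coefficient of x^4 and turns l^4 (a n + b) into l^4 (b + E_ac(n)). The constant terms differ by
    v_0 + v_0^2, an element of AS(k). *)
Lemma form_act (C C' : curve k) (g : affine_group k) :
  (exists2 v : {poly k}, (size v <= 3)%N &
     rhs_poly C \Po (lin g *: 'X + (trans g)%:P) = v ^+ 2 + v + rhs_poly C') <->
  curve_class ch2 C' = act (curve_class ch2 C) g.
Proof.
set l := lin g; set n := trans g.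
set a := val (cv_a C); set b := cv_b C; set c := cv_c C.
pose s := a * l * n ^+ 4 + c * l * n ^+ 2.
pose r := c * l ^+ 2 * n + s ^+ 2.
have z (x : k) : x + x = 0 := addrr_pchar2 ch2 x.
have rE : r ^+ 2 = l ^+ 4 * (c ^+ 2 * n ^+ 2 + a ^+ 4 * n ^+ 16 + c ^+ 4 * n ^+ 8).
  by rewrite /r /s !(D2 ch2); ring.
have bE : l ^+ 4 * (b + E_poly a c n) = l ^+ 4 * (a * n + b) + r ^+ 2.
  by rewrite rE /E_poly; ring.
have aE : coef_a (act (curve_class ch2 C) g) = l ^+ 5 * a by [].
split=> [[v sv]|e].
  rewrite rhs_comp_affine quadratic_AS // -/a -/b -/c => /sextuple_inj.
  case=> a5 b4 c3 [r2 s1 d0].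
  have vr : v`_2 = r by rewrite /r r2 -s1 -/s addrAC z add0r.
  apply: NN_eq; rewrite /coef_b /coef_c /coef_d /act /=.
  - by rewrite aE a5.
  - by rewrite [RHS]bE b4 -vr -addrA z addr0.
  - by rewrite -c3.
  - rewrite -[RHS]AS_classD d0 !AS_classD AS_class_sq.
    by rewrite -{1}(AS_classN ch2 v`_0) addNr add0r.
have ad : coef_a (curve_class ch2 C') = l ^+ 5 * a by rewrite e.
have bd : cv_b C' = l ^+ 4 * (b + E_poly a c n).
  by have := congr1 (@coef_b _ _) e.
have cd : cv_c C' = l ^+ 3 * c by have := congr1 (@coef_c _ _) e.
have := congr1 (@coef_d _ _) e; rewrite /coef_d /= -AS_classD => dd.
have [t tE] : exists t, a * n ^+ 5 + b * n ^+ 4 + c * n ^+ 3 + cv_d C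
    = t + t ^+ 2 + cv_d C'.
  have [|t ht] := (AS_class_eq0 ch2 (a * n ^+ 5 + b * n ^+ 4 + c * n ^+ 3 + cv_d C
      + cv_d C')).1.
    by rewrite AS_classD dd -{1}(AS_classN ch2) addNr.
  by exists t; rewrite -ht -[RHS]addrA z addr0.
have sv : (size (r *: 'X^2 + s *: 'X + t%:P)%R <= 3)%N.
  apply/leq_sizeP => i i3; rewrite !(coefD, coefZ, coefXn, coefX, coefC).
  by case: i i3 => [|[|[|i]]] //= _; rewrite !mulr0 !addr0.
exists (r *: 'X^2 + s *: 'X + t%:P) => //.
rewrite rhs_comp_affine quadratic_AS //.
rewrite !(coefD, coefZ, coefXn, coefX, coefC) /= !(mulr0, mulr1, addr0, add0r).
rewrite -/a -/b -/c tE [val _]ad bd cd bE; congr sextuple.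
- by rewrite -addrA z addr0.
- by rewrite /r addrCA z addr0.
Qed.

(** A single triple of forms covers the whole curve. Since v has degree at most 2, its
    homogenization of weight 3 is divisible by Z, so infinity goes to (l : 0 : 0), with scale l. *)
Lemma form_morphism (C C' : curve k) l n (v : {poly k})
    (phi : point iota C -> point iota C') :
  l != 0 -> (size v <= 3)%N -> phi (Infinity iota C) = Infinity iota C' ->
  (forall T, affine T -> [/\ affine (phi T), px (phi T) = iota l * px T + iota n
     & py (phi T) = py T + ieval iota v (px T)]) ->
  is_morphism phi.
Proof.
move=> l0 sv phiI phiA.
pose X : {mpoly k[3]} := 'X_0; pose Y : {mpoly k[3]} := 'X_1.
pose Z : {mpoly k[3]} := 'X_ord_max.
pose F : poly_map k := triple (l%:MP * X + n%:MP * Z)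
  (Y + ((v`_2)%:MP * X ^+ 2 * Z + (v`_1)%:MP * X * Z ^+ 2 + (v`_0)%:MP * Z ^+ 3)) Z.
have hX i : ('X_i : {mpoly k[3]}) \is (wt i).-homog for weight.
  rewrite dhomogX /= /weight (bigD1 i) //= mnm1E eqxx muln1 big1 ?addn0 //.
  by move=> j ji; rewrite mnm1E eq_sym (negbTE ji) muln0.
have hC (c : k) d (G : {mpoly k[3]}) : G \is d.-homog for weight ->
    c%:MP * G \is d.-homog for weight.
  by move=> hG; rewrite mul_mpolyC; exact: rpredZ.
have hF : wformed 1 F.
  apply: ord3_ind; rewrite /F /triple (tnth_nth 0) /= mul1n.
  - by apply: dhomogD; apply: hC; exact: hX.
  - apply: dhomogD; first exact: hX.
    apply: dhomogD; [apply: dhomogD|].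
    + by rewrite -mulrA; apply: hC; exact: (dhomogM (dhomogMn 2 (hX ord0)) (hX ord_max)).
    + by rewrite -mulrA; apply: hC; exact: (dhomogM (hX ord0) (dhomogMn 2 (hX ord_max))).
    + by apply: hC; exact: (dhomogMn 3 (hX ord_max)).
  - exact: hX.
have F0 u : peval iota F u ord0 = iota l * u ord0 + iota n * u ord_max.
  rewrite /peval /F /triple (tnth_nth 0) /=.
  by rewrite rmorphD !rmorphM /= !mmapC !mmapX !mmap1U.
have F1 u : peval iota F u 1 = u 1 + (iota v`_2 * u ord0 ^+ 2 * u ord_max
    + iota v`_1 * u ord0 * u ord_max ^+ 2 + iota v`_0 * u ord_max ^+ 3).
  rewrite /peval /F /triple (tnth_nth 0) /=.
  do ![rewrite ?(mmapX, mmapC, mmap1U) /=; rewrite (rmorphD, rmorphM, rmorphXn) /=].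
  by rewrite !(mmapX, mmapC, mmap1U).
have F2 u : peval iota F u ord_max = u ord_max.
  by rewrite /peval /F /triple (tnth_nth 0) /= mmapX mmap1U.
have FE T : exists2 t, t != 0 &
    forall i, peval iota F (coords T) i = t ^+ wt i * coords (phi T) i.
  have [aT|/naffine ->] := boolP (affine T).
    have [aphiT hx hy] := phiA T aT; exists 1; first exact: oner_neq0.
    apply: ord3_ind; rewrite ?F0 ?F1 ?F2 !coords_affine // /triple !(tnth_nth 0) /=;
      rewrite ?hx ?hy ?expr1n ?mul1r ?mulr1 //.
    rewrite /ieval (@horner_coef_wide _ 3) ?size_map_poly //.
    by rewrite !big_ord_recr big_ord0 /= !coef_map /=; ring.
  exists (iota l); first by rewrite fmorph_eq0.
  rewrite phiI.
  by apply: ord3_ind; rewrite ?F0 ?F1 ?F2 /= /triple !(tnth_nth 0) /=;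
    rewrite /wt /=; ring.
move=> P; exists 1%N, F; split=> // [|Q _].
  have [t t0 ht] := FE P; have [i hi] := coords_neq0 (phi P); exists i.
  by rewrite ht mulf_neq0 // expf_neq0.
by have [t t0 ht] := FE Q; exists t.
Qed.

Section AffineFun.
Variables (C C' : curve k) (l n : k) (v : {poly k}).
Hypothesis lnv : rhs_poly C' \Po (l *: 'X + n%:P) = v ^+ 2 + v + rhs_poly C.

Lemma affine_fun_subproof (x y : K) : y ^+ 2 + y == curve_rhs iota C x ->
  (y + ieval iota v x) ^+ 2 + (y + ieval iota v x)
    == curve_rhs iota C' (iota l * x + iota n).
Proof.
move=> /eqP h; have -> : iota l * x + iota n = ieval iota (l *: 'X + n%:P) x.
  by rewrite !ievalE.
rewrite -ieval_rhs -ieval_comp lnv.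
rewrite [ieval _ (_ + rhs_poly C) _]ievalD [ieval _ (_ + v) _]ievalD ievalXn.
rewrite ieval_rhs -h (D2 (rmorph_pchar iota ch2)).
by apply/eqP; ring.
Qed.

Definition affine_fun (P : point iota C) : point iota C' :=
  match P with
  | Affine x y h => Affine (affine_fun_subproof h)
  | Infinity => Infinity iota C'
  end.

Lemma affine_funE T : affine T ->
  [/\ affine (affine_fun T), px (affine_fun T) = iota l * px T + iota n
    & py (affine_fun T) = py T + ieval iota v (px T)].
Proof. by case: T. Qed.

End AffineFun.

Lemma isom_of_form (C C' : curve k) l n (v : {poly k}) : l != 0 -> (size v <= 3)%N ->
  rhs_poly C' \Po (l *: 'X + n%:P) = v ^+ 2 + v + rhs_poly C ->
  exists phi : isom iota C C', forall T, affine T ->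
    [/\ affine (fwd phi T), px (fwd phi T) = iota l * px T + iota n
      & py (fwd phi T) = py T + ieval iota v (px T)].
Proof.
move=> l0 sv e; have ch2K : 2%N \in [pchar K] := rmorph_pchar iota ch2.
(* The inverse is x -> (x - n)/l with y -> y + v((x - n)/l): in characteristic two, adding the same
   value of v twice cancels. *)
pose m := l^-1 *: 'X + (- (l^-1 * n))%:P.
pose v' := v \Po m.
have sm : (size m <= 2)%N.
  apply/leq_sizeP => i i2; rewrite !(coefD, coefZ, coefX, coefC).
  by case: i i2 => [|[|i]] //= _; rewrite !mulr0 !addr0.
have sv' : (size v' <= 3)%N.
  apply: leq_trans (size_comp_poly_leq _ _) _; move: sv sm.
  by set a := size v; set b := size m; nia.
have ch2P : 2%N \in [pchar {poly k}] by rewrite pchar_poly.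
have mK : (l *: 'X + n%:P) \Po m = 'X.
  rewrite rmorphD /= linearZ /= comp_polyX comp_polyC /m scalerDr scalerA mulfV //.
  rewrite scale1r -addrA -mul_polyC -polyCM -polyCD mulrN mulrA.
  by rewrite mulfV // mul1r addNr addr0.
have e' : rhs_poly C \Po m = v' ^+ 2 + v' + rhs_poly C'.
  have := congr1 (fun p => p \Po m) e; rewrite -comp_polyA mK comp_polyXr.
  rewrite !rmorphD rmorphXn /= -/v' => ->; rewrite addrA -[LHS]add0r; congr (_ + _).
  by rewrite (addrr_pchar2 ch2P).
have K1 : cancel (affine_fun e) (affine_fun e').
  move=> T; have [aT|/naffine -> //] := boolP (affine T).
  have [a1 x1 y1] := affine_funE e aT; have [a2 x2 y2] := affine_funE e' a1.
  have X2 : px (affine_fun e' (affine_fun e T)) = px T.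
    by rewrite x2 x1 fmorphV rmorphN rmorphM fmorphV; field; rewrite fmorph_eq0.
  apply: point_eq => //; rewrite y2 y1 /v' ieval_comp.
  have -> : ieval iota m (px (affine_fun e T)) = px T.
    by rewrite -X2 x2 !ievalE.
  by rewrite -addrA (addrr_pchar2 ch2K) addr0.
have K2 : cancel (affine_fun e') (affine_fun e).
  move=> T; have [aT|/naffine -> //] := boolP (affine T).
  have [a1 x1 y1] := affine_funE e' aT; have [a2 x2 y2] := affine_funE e a1.
  have mE : ieval iota m (px T) = px (affine_fun e' T) by rewrite x1 !ievalE.
  apply: point_eq => //.
    by rewrite x2 x1 fmorphV rmorphN rmorphM fmorphV; field; rewrite fmorph_eq0.
  rewrite y2 y1 /v' ieval_comp mE.
  by rewrite -addrA (addrr_pchar2 ch2K) addr0.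
have M1 := form_morphism l0 sv
  (erefl : affine_fun e (Infinity iota C) = _) (affine_funE e).
have M2 : is_morphism (affine_fun e').
  apply: (form_morphism _ sv' _ (affine_funE e')) => //.
  by rewrite invr_eq0.
by exists (Isom K1 K2 M1 M2); exact: affine_funE.
Qed.

End AffineIsomorphisms.

(** * Automorphisms *)

Section AffinePart.
Variables (k : fieldType) (ch2 : 2%N \in [pchar k]).
Variables (K : closedFieldType) (iota : {rmorphism k -> K}).

Definition acts_on_x (C C' : curve k) (phi : point iota C -> point iota C')
    (g : affine_group k) : Prop :=
  forall T, affine T -> px (phi T) = iota (lin g) * px T + iota (trans g).

Lemma acts_on_x_inj (C C' : curve k) (phi : point iota C -> point iota C') g h :
  acts_on_x phi g -> acts_on_x phi h -> g = h.
Proof.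
move=> phig phih.
have e x : iota (lin g) * x + iota (trans g) = iota (lin h) * x + iota (trans h).
  by have [T aT <-] := point_above iota C x; rewrite -phig // phih.
have tE : trans g = trans h.
  by apply: (fmorph_inj iota); have := e 0; rewrite !mulr0 !add0r.
apply: aff_eq => //; apply: (fmorph_inj iota); have := e 1.
by rewrite tE !mulr1 => /addIr.
Qed.

Lemma isom_affine_part (C C' : curve k) (phi : isom iota C C') :
  exists (g : affine_group k) (v : {poly k}),
  [/\ acts_on_x (fwd phi) g, (size v <= 3)%N,
      rhs_poly C' \Po (lin g *: 'X + (trans g)%:P) = v ^+ 2 + v + rhs_poly C
    & forall T, affine T -> py (fwd phi T) = py T + ieval iota v (px T)].
Proof.
have [l [n [v [l0 sv e hv]]]] := isom_form ch2 phi.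
by exists (Sub l l0, n), v; split=> // T aT; case: (hv T aT).
Qed.

(** Recording the affine map serves both parts: existence of some g classifies the curves, and the
    case C' = C describes which g come from automorphisms. Substituting in the equation of C gives a
    map from C' to C. *)
Lemma acts_on_x_act (C C' : curve k) g :
  curve_class ch2 C' = act (curve_class ch2 C) g <->
  exists phi : isom iota C' C, acts_on_x (fwd phi) g.
Proof.
rewrite -form_act; split=> [[v sv e]|[phi phig]].
  have [phi hphi] := isom_of_form ch2 iota (lin_neq0 g) sv e.
  by exists phi => T aT; case: (hphi T aT).
have [h [v [phih sv e _]]] := isom_affine_part phi.
by rewrite (acts_on_x_inj phig phih); exists v.
Qed.

Variable C : curve k.

(** The choice is harmless since g is unique by [acts_on_x_inj]; the same uniqueness yields
    multiplicativity. *)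
Definition affine_part (phi : Aut iota C) : affine_group k :=
  projT1 (cid (isom_affine_part phi)).

Lemma affine_partP (phi : Aut iota C) : acts_on_x (fwd phi) (affine_part phi).
Proof. by rewrite /affine_part; case: cid => g /= [v []]. Qed.

Lemma affine_partM : {morph affine_part : phi psi / (phi * psi)%g}.
Proof.
move=> phi psi; apply: (acts_on_x_inj (affine_partP _)) => T aT.
rewrite [LHS](affine_partP phi) ?(affine_fwd ch2) // affine_partP //.
by rewrite linM transM !(rmorphD, rmorphM) /=; ring.
Qed.

Lemma affine_part1 : affine_part 1%g = 1%g.
Proof.
apply: (acts_on_x_inj (affine_partP _)) => T aT.
by rewrite lin1 trans1 rmorph1 rmorph0 mul1r addr0.
Qed.

HB.instance Definition _ := isUMagmaMorphism.Build (Aut iota C) (affine_group k)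
  affine_part (conj affine_part1 affine_partM).

Lemma affine_part_induces phi : induces (fwd phi) (affine_part phi).
Proof.
have [g [v [phig _ _ hv]]] := isom_affine_part phi.
rewrite (acts_on_x_inj (affine_partP phi) phig).
exists v, 1; split=> [|x y h _]; first exact: oner_neq0.
rewrite rmorph1 hornerC divr1.
have := affine_fwd ch2 phi (isT : affine (Affine h)).
have := phig (Affine h) isT; have := hv (Affine h) isT.
case: (fwd phi _) => //= x' y' h' ey ex _.
by rewrite -ex -ey; exists h'.
Qed.

(** For the trivial affine map the equation reduces to v (v + 1) = 0 in k[x]: v = 0 is the identity
    and v = 1 the involution. *)
Lemma affine_part_eq1 (phi : Aut iota C) : affine_part phi = 1%g <->
  in_cyclic_subgroup (hyp_inv ch2 iota C) phi.
Proof.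
have hyp1 : affine_part (hyp_inv ch2 iota C) = 1%g.
  apply: (acts_on_x_inj (affine_partP _)) => T aT.
  by rewrite lin1 trans1 rmorph1 rmorph0 mul1r addr0; case: T aT.
split=> [phi1|[n [->|->]]]; last 2 first.
- by rewrite gmulfXn /= hyp1 expg1n.
- by rewrite gmulfXVn /= hyp1 expg1n invg1.
have [g [v [phig _ e hv]]] := isom_affine_part phi.
have g1 := acts_on_x_inj (affine_partP phi) phig; rewrite phi1 in g1.
rewrite -{g}g1 in phig e.
have px_phi T : affine T -> px (fwd phi T) = px T.
  by move=> aT; rewrite phig // lin1 trans1 rmorph1 rmorph0 mul1r addr0.
have {e} : v * (v + 1) == 0.
  move: e; rewrite lin1 trans1 scale1r addr0 comp_polyXr => /esym/eqP.
  rewrite -subr_eq0 addrK => /eqP <-; apply/eqP; ring.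
rewrite mulf_eq0 => /orP[/eqP v0|v1].
  exists 0%N; left; apply: isom_eq => T.
  have [aT|/naffine ->] := boolP (affine T); last by rewrite (fwd_infty ch2).
  apply: point_eq => //; first exact: affine_fwd.
    exact: px_phi.
  by rewrite hv // v0 ieval0 addr0.
exists 1%N; left; apply: isom_eq => T.
have [aT|/naffine ->] := boolP (affine T); last by rewrite (fwd_infty ch2).
have ahT : affine (hyp_fun ch2 T) by rewrite affine_hyp.
apply: point_eq => //; first exact: affine_fwd.
  by rewrite px_hyp px_phi.
rewrite hv //; have -> : ieval iota v (px T) = 1.
  have := congr1 (ieval iota ^~ (px T)) (eqP v1); rewrite /= ievalD ieval1 ieval0.
  move=> /eqP; rewrite addr_eq0 (oppr_pchar2 (rmorph_pchar iota ch2)).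
  by move/eqP.
by case: T aT {ahT}.
Qed.

End AffinePart.

(** The first coordinate forces l^5 = 1; multiplying the second by l then gives E = b (1 + l). If c
    is nonzero, also l^3 = 1, so l = l^6 = 1 and E = 0. The last coordinate is translated by
    delta. *)
Lemma act_fixed (k : fieldType) (ch2 : 2%N \in [pchar k]) (n : NN ch2) g :
  act n g = n <-> g \in ker_delta ch2 (coef_a n) (coef_b n) (coef_c n).
Proof.
set a := coef_a n; set b := coef_b n; set c := coef_c n; set l := lin g.
have z (x : k) : x + x = 0 := addrr_pchar2 ch2 x.
have a0 : a != 0 := valP n.1.1.1.
have aE : coef_a (act n g) = l ^+ 5 * a by [].
have bE : coef_b (act n g) = l ^+ 4 * (b + E_poly a c (trans g)) by [].
have cE : coef_c (act n g) = l ^+ 3 * c by [].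
have dE : coef_d (act n g) = delta ch2 a b c g + coef_d n by [].
have -> : (g \in ker_delta ch2 a b c) =
  (g \in Gamma_abc a b c) && (delta ch2 a b c g == 0) by [].
rewrite -(rwP andP) -(rwP (Gamma_abcP a b c g)) -(rwP eqP) -/l.
split=> [e|[Gg dg]].
- have l5 : l ^+ 5 = 1.
    by apply: (mulIf a0); rewrite -aE e mul1r.
  have l4 : E_poly a c (trans g) = b * (1 + l).
    have bl : b + E_poly a c (trans g) = l * b.
      have eb : l ^+ 4 * (b + E_poly a c (trans g)) = b by rewrite -bE e.
      by rewrite -[in RHS]eb mulrA -exprS l5 mul1r.
    by rewrite -[LHS]add0r -(z b) -addrA bl; ring.
  split; last by apply: (addIr (coef_d n)); rewrite -dE e add0r.
  have [c0|c0] := eqVneq c 0 => //=.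
  have l3 : l ^+ 3 = 1 by apply: (mulIf c0); rewrite -cE e mul1r.
  have l1 : l = 1 by rewrite -[l]mulr1 -l5 -exprS (exprM l 3 2) l3 expr1n.
  by rewrite l4 l1 z mulr0.
- have [l5 l4 l3] : [/\ l ^+ 5 = 1, l ^+ 4 * (b + E_poly a c (trans g)) = b & l ^+ 3 * c = c].
    move: Gg; have [c0|c0] := eqVneq c 0 => /= -[l1 El].
      split=> //; last by rewrite c0 mulr0.
      rewrite El [_ + _](_ : _ = (b + b) + l * b); last by ring.
      by rewrite z add0r mulrA -exprSr l1 mul1r.
    by rewrite l1 El addr0 !expr1n !mul1r.
  apply: NN_eq; rewrite ?aE ?bE ?cE ?dE ?l5 ?l3 ?l4 ?mul1r //.
  by rewrite dg add0r.
Qed.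

Theorem proposition16 (k : fieldType) (ch2 : 2%N \in [pchar k])
    (K : closedFieldType) (iota : {rmorphism k -> K})
    (k_perfect : perfect_field k) (K_closure : is_algebraic_closure iota) :
  (forall (n n' : NN ch2) (C C' : curve k),
     curve_class ch2 C = n -> curve_class ch2 C' = n' ->
     (isomorphic iota C' C <->
      exists g : affine_group k, n' = act n g))
  /\
  (forall n : NN ch2,
     (forall g : affine_group k,
        act n g = n <-> g \in ker_delta ch2 (coef_a n) (coef_b n) (coef_c n))
     /\
     (forall C : curve k, curve_class ch2 C = n ->
        exists rho : {multiplicative Aut iota C -> affine_group k},
          [/\ forall phi : Aut iota C, induces (fwd phi) (rho phi),
              forall phi : Aut iota C,
                rho phi = 1%g <-> in_cyclic_subgroup (hyp_inv ch2 iota C) phi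
            & forall g : affine_group k,
                g \in ker_delta ch2 (coef_a n) (coef_b n) (coef_c n) <->
                exists phi : Aut iota C, rho phi = g])).
Proof.
have part1 (n n' : NN ch2) (C C' : curve k) : curve_class ch2 C = n ->
    curve_class ch2 C' = n' -> forall g : affine_group k, n' = act n g <->
    exists phi : isom iota C' C, acts_on_x (fwd phi) g.
  by move=> <- <- g; exact: acts_on_x_act.
split=> [n n' C C' Cn Cn'|n].
  split=> [[phi]|[g] /(part1 _ _ _ _ Cn Cn' g)[phi _]]; last by exists.
  have [g [v [phig _ _ _]]] := isom_affine_part ch2 phi.
  by exists g; apply/(part1 _ _ _ _ Cn Cn' g); exists phi.
split=> [g|C Cn]; first exact: act_fixed.
exists (affine_part ch2 (iota := iota) (C := C)); split=> [phi|phi|g].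
- exact: affine_part_induces.
- exact: affine_part_eq1.
(* The kernel is the isotropy group of the class of C, and g fixes this class exactly when it comes
   from an isomorphism of C with itself. *)
rewrite -act_fixed; split=> [e|[phi <-]].
  have [phi phig] := (part1 _ _ _ _ Cn Cn g).1 (esym e).
  exists phi; exact: acts_on_x_inj (affine_partP ch2 phi) phig.
apply/esym/(part1 _ _ _ _ Cn Cn); exists phi; exact: affine_partP.
Qed.
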